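(* Let $G$ be a simple graph on $n$ vertices that contains no cycle having two chords incident to a common vertex. Then \[ \rho(G)\le \begin{cases} n-1&\text{if }n\le 4,\\ 3.0861&\text{if }n=5,\\ \frac{1}{2}+\sqrt{2n-\frac{15}{4}}&\text{if }6\le n\le 9,\\ \sqrt{3(n-3)}&\text{if }n\ge 10, \end{cases} \] with equality if and only if $G\cong K_n$ when $n\le 4$, $G\cong F_1$ when $n=5$, $G\cong K_{1,1,n-2}$ when $6\le n\le 9$, and $G\cong K_{3,n-3}$ when $n\ge 10$.
   Context: All graphs are finite and simple. $\rho(G)$ denotes the spectral radius of $G$ (largest eigenvalue of the adjacency matrix). For a cycle $C$ in $G$, a chord is an edge of $G$ joining two vertices of $C$ that is not an edge of $C$. A DCC$_1$ is a cycle together with two of its chords that share a common end vertex; $G$ contains a DCC$_1$ if some cycle of $G$ has two chords incident to the same vertex. $F_1$ is the graph on $5$ vertices obtained from $K_2$ and $K_4$ by identifying a vertex of $K_2$ with a vertex of $K_4$. $K_{1,1,n-2}$ is the complete tripartite graph with parts of sizes $1,1,n-2$, and $K_{3,n-3}$ the complete bipartite graph with parts of sizes $3$ and $n-3$. The value $3.0861$ is the (rounded) spectral radius of $F_1$.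
   Formalization: For n=5 the decimal 3.0861 is replaced by the exact spectral radius of F_1 (about 3.08613, so the literal bound and its equality case fail for F_1 itself); the decimal value is not proved. The graph is assumed to have at least one vertex. *)

(* Defs.v *)
From HB Require Import structures.
From mathcomp Require Import all_boot all_order all_algebra.
From mathcomp Require Import fingroup perm.
From mathcomp Require Import polyrcf.
Set Implicit Arguments. Unset Strict Implicit. Unset Printing Implicit Defensive.
Import Order.TTheory GRing.Theory Num.Theory.
Local Open Scope ring_scope.

Definition simple_graph n (e : rel 'I_n) := symmetric e /\ irreflexive e.

Definition adj_mx (R : nzRingType) n (e : rel 'I_n) : 'M[R]_n :=
  \matrix_(i, j) (e i j)%:R.

(* largest eigenvalue = largest real root of the characteristic polynomial
   (rootsR lists the real roots in increasing order; 0 if there are none) *)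
Definition lambda_max (R : rcfType) n (A : 'M[R]_n) : R :=
  last 0 (rootsR (char_poly A)).

Definition spectral_radius (R : rcfType) n (e : rel 'I_n) : R :=
  lambda_max (adj_mx R e).

Definition graph_iso n (e e' : rel 'I_n) :=
  exists f : {perm 'I_n}, forall x y, e x y = e' (f x) (f y).

(* chords of a cycle c (a duplicate-free sequence of >= 3 vertices, read
   cyclically): edges between two vertices of c that are not cycle edges *)
Definition is_chord n (e : rel 'I_n) (c : seq 'I_n) (x y : 'I_n) : bool :=
  [&& x \in c, y \in c, e x y, y != next c x & x != next c y].

Definition contains_DCC1 n (e : rel 'I_n) : Prop :=
  exists c : seq 'I_n,
    [/\ uniq c, (3 <= size c)%N, path.cycle e c &
      exists a b d : 'I_n, [/\ b != d, is_chord e c a b & is_chord e c a d]].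

Definition complete_rel n : rel 'I_n := fun x y => x != y.

(* F_1 on 5 vertices: K_4 on {0,1,2,3} plus pendant edge {3,4} *)
Definition F1_rel : rel 'I_5 := fun x y =>
  (x != y) && (((x < 4) && (y < 4))%N || ([set x; y] == [set (inord 3 : 'I_5); inord 4])).

Definition K11_rel n : rel 'I_n := fun x y =>
  (x != y) && ~~ ((2 <= x)%N && (2 <= y)%N).

Definition K3_rel n : rel 'I_n := fun x y => (x < 3)%N != (y < 3)%N.

(* Main.v *)
Require Import Defs.
From HB Require Import structures.
From mathcomp Require Import all_boot all_order all_algebra.
From mathcomp Require Import fingroup perm.
From mathcomp Require Import polyrcf.
From mathcomp Require Import zify ring lra.
From mathcomp Require Import spectral.
From mathcomp Require Import complex.

(* Let walks2 u be the sum of the degrees of the neighbours of u, and rho the spectral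
   radius.  Summing against a nonnegative eigenvector turns a bound
   walks2 u <= K + c deg u at all vertices u into rho^2 <= K + c rho.

   A graph contains a DCC1 iff for some vertex v a path avoiding v meets N(v) in at
   least four vertices.  If it contains none, then one of the following holds:
   (i) walks2 u <= 3(n - 3) for all u;
   (ii) walks2 u <= 2(n - 2) + deg u for all u;
   (iii) some u is the centre of a windmill of K_4's with at most one extra pendant
   vertex, and then walks2 v <= n - 1 + 2 deg v for all v.
   Case (i) is sharp for K_{3,n-3} and (ii) for K_{1,1,n-2}, and comparing the three
   resulting bounds on rho gives the theorem.

   For the trichotomy, fix u and split G - u into components D.  If D does not contain
   exactly three neighbours of u, no cycle of D meets N(u) three times, and this
   sparsity bounds the degree sum over D and N(u) by 2(|D| - 1).  If D contains exactly
   three, the number of edges among them decides: three give (iii), one or two are as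
   good as before, and none violates (ii) only if G contains K_{3,6}, a case in which
   (i) holds everywhere.

   In the case of equality, the support of the eigenvector is closed under adjacency
   and contains a vertex of degree at most 3, an endpoint of a longest path; equality
   at this vertex and its neighbours determines G. *)

Set Implicit Arguments. Unset Strict Implicit. Unset Printing Implicit Defensive.
Import Order.TTheory GRing.Theory Num.Theory.

(** * Perron vectors of graphs *)

Local Open Scope ring_scope.

(** * Rayleigh quotients of real symmetric matrices *)

Section SymmetricMatrix.
Variable R : rcfType.
Notation toC := (real_complex R).

Lemma lambda_max_ge n (A : 'M[R]_n) a :
  root (char_poly A) a -> a <= lambda_max A.
Proof.
move=> ra; have p0 : char_poly A != 0 by rewrite monic_neq0 // char_poly_monic.
have : a \in rootsR (char_poly A) by rewrite -(roots_on_rootsR p0) ra in_itv.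
rewrite /lambda_max; set s := rootsR _.
have : path.sorted <%R s by rewrite /s /rootsR sorted_roots.
case/lastP: s => [|s b] //; rewrite last_rcons mem_rcons inE.
rewrite (sorted_pairwise lt_trans) pairwise_rcons => /andP[/allP sb _].
by case/predU1P => [->//|/sb/ltW].
Qed.

(** The root [a] makes the list of real roots nonempty, so that [last] does not fall back on its
    default [0]. *)
Lemma lambda_max_root n (A : 'M[R]_n) a :
  root (char_poly A) a -> root (char_poly A) (lambda_max A).
Proof.
move=> ra; have p0 : char_poly A != 0 by rewrite monic_neq0 // char_poly_monic.
have sa : a \in rootsR (char_poly A) by rewrite -(roots_on_rootsR p0) ra in_itv.
have : lambda_max A \in rootsR (char_poly A).
  rewrite /lambda_max; case: (rootsR _) sa => // b s _ /=; exact: mem_last.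
by rewrite -(roots_on_rootsR p0) => /andP[].
Qed.

Variables (n : nat) (A : 'M[R]_n).
Hypothesis symA : A^T = A.

Let AC := map_mx toC A.
Let P := spectralmx AC.
Let d := spectral_diag AC.

Let conjC_real m (y : 'rV[R]_m) : map_mx Num.conj (map_mx toC y) = map_mx toC y.
Proof. by apply/matrixP=> i j; rewrite !mxE; apply/CrealP; rewrite complex_real. Qed.

Let AC_herm : AC \is hermsymmx.
Proof.
apply: realsym_hermsym.
  by apply/is_hermitianmxP/matrixP=> i j; rewrite scale1r !mxE -[in LHS]symA mxE.
by apply/mxOverP=> i j; rewrite mxE complex_real.
Qed.

Let AC_eq : AC = invmx P *m diag_mx d *m P.
Proof. exact/orthomx_spectralP/hermitian_normalmx/AC_herm. Qed.

(** The entries of [d] come from a unitary diagonalization over the complex numbers. Hermitian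
    symmetry makes them real, and row [i] of [P] is a left eigenvector for entry [i]. *)
Let d_real i : exists2 k, d 0 i = toC k & root (char_poly A) k.
Proof.
have /mxOverP/(_ 0 i) := hermitian_spectral_diag_real AC_herm.
rewrite -/AC -/d => /complex_realP[k dk]; exists k => //.
suff : root (char_poly AC) (toC k).
  by rewrite /AC -map_char_poly fmorph_root.
rewrite -eigenvalue_root_char; apply/eigenvalueP.
have Pu : P \in unitmx by apply: spectral_unit.
exists (row i P).
  rewrite AC_eq -row_mul !mulmxA mulmxV // mul1mx row_mul row_diag_mx -scalemxAl.
  by rewrite -rowE dk.
apply: contraTneq Pu => Pi0; rewrite unitmxE unitfE negbK.
apply/eqP; rewrite (expand_det_row _ i) big1 // => j _.
by move/rowP/(_ j): Pi0; rewrite !mxE => ->; rewrite mul0r.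
Qed.

Let z (y : 'rV[R]_n) := map_mx toC y *m invmx P.

(** In the coordinates [z y] of the unitary eigenbasis both quadratic forms are diagonal. The gap in
    the Rayleigh inequality thus becomes a sum of nonnegative terms, which yields both the
    inequality and its equality case. *)
Let rayleigh_expand y :
  toC (lambda_max A * (y *m y^T) 0 0 - (y *m A *m y^T) 0 0) =
  \sum_i (toC (lambda_max A) - d 0 i) * `|z y 0 i| ^+ 2.
Proof.
have Pu : P \is unitarymx by apply: spectral_unitarymx.
have zc : map_mx Num.conj (z y)^T = P *m map_mx toC y^T.
  rewrite /z invmx_unitary // trmx_mul map_mxM -!map_trmx trmxK -map_mx_comp.
  rewrite (map_mx_id (@conjCK _)); congr (_ *m _).
  exact: (congr1 trmx (conjC_real y)).
have -> : toC (lambda_max A * (y *m y^T) 0 0 - (y *m A *m y^T) 0 0) =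
   toC (lambda_max A) * (map_mx toC (y *m y^T)) 0 0
   - (map_mx toC (y *m A *m y^T)) 0 0.
  by rewrite !mxE rmorphB rmorphM.
have -> : map_mx toC (y *m y^T) = z y *m map_mx Num.conj (z y)^T.
  by rewrite zc /z mulmxA mulmxKV ?spectral_unit // map_mxM.
have -> : map_mx toC (y *m A *m y^T) = z y *m diag_mx d *m map_mx Num.conj (z y)^T.
  by rewrite zc !map_mxM -/AC AC_eq /z !mulmxA.
rewrite !mxE mulr_sumr -sumrB; apply: eq_bigr => i _.
rewrite mul_mx_diag !mxE normCK; ring.
Qed.

Lemma rayleigh_le (y : 'rV[R]_n) :
  (y *m A *m y^T) 0 0 <= lambda_max A * (y *m y^T) 0 0.
Proof.
rewrite -subr_ge0 -lecR rayleigh_expand sumr_ge0 // => i _.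
have [k -> /lambda_max_ge le_k] := d_real i.
by rewrite mulr_ge0 ?exprn_ge0 // subr_ge0 lecR.
Qed.

(** If the gap vanishes, every coordinate of [y] in the eigenbasis is zero or belongs to the largest
    eigenvalue. *)
Lemma rayleigh_eq (y : 'rV[R]_n) :
  (y *m A *m y^T) 0 0 = lambda_max A * (y *m y^T) 0 0 ->
  y *m A = lambda_max A *: y.
Proof.
move=> eq_y; have := rayleigh_expand y.
rewrite eq_y subrr => /esym/eqP; rewrite psumr_eq0; last first.
  move=> i _; have [k -> /lambda_max_ge le_k] := d_real i.
  by rewrite mulr_ge0 ?exprn_ge0 // subr_ge0 lecR.
move/allP=> z0; apply: (@map_mx_inj _ _ toC).
rewrite map_mxM -/AC AC_eq map_mxZ !mulmxA -/(z y).
suff -> : z y *m diag_mx d = toC (lambda_max A) *: z y.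
  by rewrite -scalemxAl mulmxKV ?spectral_unit.
apply/rowP=> i; rewrite mul_mx_diag !mxE -/(z y).
have := z0 i (mem_index_enum i); rewrite mulf_eq0 expf_eq0 /= normr_eq0.
by rewrite subr_eq0 mxE => /orP[/eqP->|/eqP->]; rewrite ?mulr0 ?mul0r // mulrC.
Qed.

Lemma char_poly_root_sym : (0 < n)%N -> exists a, root (char_poly A) a.
Proof.
by move=> n0; have [k _ rk] := d_real (Ordinal n0); exists k.
Qed.

End SymmetricMatrix.

Definition nbr (T : finType) (e : rel T) (v : T) : {set T} := [set w | e v w].

(** The number of walks of length two starting at [u], that is, the row sum at [u] of the square of
    the adjacency matrix. *)
Definition walks2 (T : finType) (e : rel T) (u : T) : nat :=
  (\sum_(v in nbr e u) #|nbr e v|)%N.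

Lemma in_nbr (T : finType) (e : rel T) v w : (w \in nbr e v) = e v w.
Proof. by rewrite inE. Qed.

Section Perron.
Variables (R : rcfType) (n : nat) (e : rel 'I_n).
Hypotheses (n_gt0 : (0 < n)%N) (e_sym : symmetric e).
Notation rho := (spectral_radius R e).

Let adj_sym : (adj_mx R e)^T = adj_mx R e.
Proof. by apply/matrixP=> i j; rewrite !mxE e_sym. Qed.

Let quad (y : 'rV[R]_n) :
  (y *m adj_mx R e *m y^T) 0 0 = \sum_i \sum_j y 0 i * (e i j)%:R * y 0 j.
Proof.
rewrite mxE exchange_big; apply: eq_bigr => j _ /=.
by rewrite !mxE mulr_suml; apply: eq_bigr => i _; rewrite !mxE.
Qed.

(* The entrywise absolute value of an eigenvector still maximizes the Rayleigh
   quotient, hence is an eigenvector. *)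
Lemma perron_vector : exists x : 'I_n -> R,
  [/\ forall u, 0 <= x u, exists u, 0 < x u &
      forall u, \sum_(v in nbr e u) x v = rho * x u].
Proof.
have [a ra] := char_poly_root_sym adj_sym n_gt0.
have := lambda_max_root ra; rewrite -eigenvalue_root_char.
case/eigenvalueP=> v vA v0; pose y : 'rV[R]_n := map_mx Num.norm v.
have yy : (y *m y^T) 0 0 = (v *m v^T) 0 0.
  by rewrite !mxE; apply: eq_bigr => i _; rewrite !mxE -!expr2 real_normK ?num_real.
have yA : y *m adj_mx R e = rho *: y.
  apply: rayleigh_eq => //; apply/eqP; rewrite eq_le rayleigh_le //=.
  rewrite yy.
  have -> : lambda_max (adj_mx R e) * (v *m v^T) 0 0 =
            (v *m adj_mx R e *m v^T) 0 0 by rewrite vA -scalemxAl [in RHS]mxE.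
  rewrite !quad; apply: ler_sum => i _; apply: ler_sum => j _.
  rewrite !mxE; apply: le_trans (ler_norm _) _.
  by rewrite !normrM normr_nat.
exists (fun u => y 0 u); split=> [u||u]; first by rewrite mxE normr_ge0.
  have [u vu] : exists u, v 0 u != 0 by apply/rV0Pn.
  by exists u; rewrite mxE normr_gt0.
move/rowP/(_ u): yA; rewrite [RHS]mxE => <-; rewrite [RHS]mxE big_mkcond /=.
by apply: eq_bigr => i _; rewrite in_nbr (e_sym u) !mxE; case: (e i u); rewrite ?mulr1 ?mulr0.
Qed.

Lemma spectral_radius_ge0 : 0 <= rho.
Proof.
have [x [x0 [u xu] xE]] := perron_vector.
by rewrite -(pmulr_lge0 _ xu) -xE sumr_ge0.
Qed.

(** Summing the eigenvalue equation over all vertices counts [x u] once for each neighbour of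
    [u]. *)
Let degree_sum (x : 'I_n -> R) :
  (forall u, \sum_(v in nbr e u) x v = rho * x u) ->
  \sum_u x u * #|nbr e u|%:R = rho * \sum_u x u.
Proof.
move=> xE; rewrite mulr_sumr -(eq_bigr _ (fun u _ => xE u)).
under [RHS]eq_bigr do rewrite big_mkcond.
rewrite exchange_big; apply: eq_bigr => u _ /=.
rewrite -sum1_card natr_sum mulr_sumr [LHS]big_mkcond.
by apply: eq_bigr => v _; rewrite !inE e_sym mulr1.
Qed.

Let walks2_sum (x : 'I_n -> R) :
  (forall u, \sum_(v in nbr e u) x v = rho * x u) ->
  \sum_u x u * (walks2 e u)%:R = rho ^+ 2 * \sum_u x u.
Proof.
move=> xE; rewrite expr2 -mulrA -(degree_sum xE) mulr_sumr.
under [RHS]eq_bigr => u _ do rewrite mulrA -xE mulr_suml big_mkcond.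
rewrite exchange_big; apply: eq_bigr => u _ /=.
rewrite natr_sum mulr_sumr [LHS]big_mkcond.
by apply: eq_bigr => v _; rewrite !inE e_sym.
Qed.

(* Summing [walks2 <= K + c * deg] against the Perron vector gives
   [rho^2 <= K + c * rho]. *)
Section Weighted.
Variables (K c : nat).
Let gap : R := K%:R + c%:R * rho - rho ^+ 2.

Let gapE (x : 'I_n -> R) :
  (forall u, \sum_(v in nbr e u) x v = rho * x u) ->
  \sum_u x u * ((K + c * #|nbr e u|)%:R - (walks2 e u)%:R) = gap * \sum_u x u.
Proof.
move=> xE.
transitivity (\sum_u (K%:R * x u + c%:R * (x u * #|nbr e u|%:R)
                 - (x u * (walks2 e u)%:R))).
  by apply: eq_bigr => u _; rewrite natrD natrM; ring.
rewrite sumrB big_split /= -!mulr_sumr degree_sum // walks2_sum // /gap; ring.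
Qed.

Lemma walks2_spectral_le : (forall u, (walks2 e u <= K + c * #|nbr e u|)%N) ->
  rho ^+ 2 <= K%:R + c%:R * rho.
Proof.
move=> le_u; have [x [x0 [u xu] xE]] := perron_vector.
rewrite -subr_ge0 -/gap.
have X0 : 0 < \sum_u x u by rewrite (bigD1 u) //= ltr_wpDr ?sumr_ge0.
rewrite -(pmulr_lge0 _ X0) -gapE // sumr_ge0 // => v _.
by rewrite mulr_ge0 // subr_ge0 ler_nat.
Qed.

Lemma walks2_spectral_eq : (forall u, walks2 e u = (K + c * #|nbr e u|)%N) ->
  rho ^+ 2 = K%:R + c%:R * rho.
Proof.
move=> eq_u; have [x [x0 [u xu] xE]] := perron_vector.
have X0 : 0 < \sum_u x u by rewrite (bigD1 u) //= ltr_wpDr ?sumr_ge0.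
apply/eqP; rewrite eq_sym -subr_eq0 -/gap -(mulIr_eq0 _ (mulIf (lt0r_neq0 X0))).
by rewrite -gapE // big1 // => v _; rewrite eq_u subrr mulr0.
Qed.

(** [S] is the support of the Perron vector. The weighted slacks sum to zero, so each slack vanishes
    where the weight is positive. At a vertex of weight zero the eigenvalue equation forces weight
    zero on all neighbours, so [S] is closed under adjacency. *)
Lemma walks2_eq_support : (forall u, (walks2 e u <= K + c * #|nbr e u|)%N) ->
  rho ^+ 2 = K%:R + c%:R * rho ->
  exists S : {set 'I_n}, [/\ S != set0,
    forall u v, u \in S -> e u v -> v \in S & forall u, u \in S -> walks2 e u = (K + c * #|nbr e u|)%N].
Proof.
move=> le_u eq_rho; have [x [x0 [u xu] xE]] := perron_vector.
exists [set u | 0 < x u]; split.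
- by apply/set0Pn; exists u; rewrite inE.
- move=> v w; rewrite !inE => xv evw; rewrite lt0r x0 andbT.
  apply: contraTneq xv => xw; rewrite -leNgt.
  have := xE w; rewrite xw mulr0 => <-.
  by rewrite (bigD1 v) ?in_nbr 1?e_sym //= lerDl sumr_ge0.
move=> v; rewrite inE => xv; apply/eqP; rewrite eqn_leq le_u /=.
have : \sum_u x u * ((K + c * #|nbr e u|)%:R - (walks2 e u)%:R) == 0.
  by rewrite gapE // /gap eq_rho subrr mul0r.
rewrite psumr_eq0; last by move=> w _; rewrite mulr_ge0 // subr_ge0 ler_nat.
move/allP/(_ v (mem_index_enum v)); rewrite mulf_eq0 gt_eqF //= subr_eq0.
by rewrite eqr_nat => /eqP ->.
Qed.
End Weighted.

End Perron.

Lemma spectral_radius_iso (R : rcfType) n (e e' : rel 'I_n) :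
  graph_iso e e' -> spectral_radius R e = spectral_radius R e'.
Proof.
case=> f fE; rewrite /spectral_radius /lambda_max; congr (last 0 (rootsR _)).
rewrite /char_poly.
have -> : char_poly_mx (adj_mx R e) = row_perm f (col_perm f (char_poly_mx (adj_mx R e'))).
  apply/matrixP=> i j; rewrite !mxE fE; congr (_ *+ _ - _).
  by rewrite (inj_eq perm_inj).
rewrite row_permE col_permE !det_mulmx !det_perm odd_permV mulrCA.
by rewrite -signr_addb addbb mulr1.
Qed.

(** * Paths and cycles meeting few vertices of a set *)

Local Close Scope ring_scope.

(** The split is at the first element satisfying [p], so the count drops by exactly one and the
    lemma can be iterated. *)
Lemma count_gt0_split (T : Type) (p : pred T) (s : seq T) : 0 < count p s ->
  exists s1 a s2, [/\ s = s1 ++ a :: s2, p a & count p s2 = (count p s).-1].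
Proof.
elim: s => //= x s IHs; case px: (p x) => /=; first by exists [::], x, s.
by move=> /IHs[s1 [a [s2 [-> pa s2E]]]]; exists (x :: s1), a, s2.
Qed.

(** Nonempty [t1] and [t2] separate [b] from [v] on both sides of the cycle. *)
Lemma chord_of_cycle_head n (e : rel 'I_n) v t1 b t2 : uniq (v :: t1 ++ b :: t2) ->
  t1 != [::] -> t2 != [::] -> e v b -> is_chord e (v :: t1 ++ b :: t2) v b.
Proof.
move=> Uc t10 t20 evb; have /= /andP[vt Ut] := Uc.
have bt1 : b \notin t1.
  by move: Ut; rewrite cat_uniq => /and3P[_ /hasPn/(_ b (mem_head _ _))].
have vb : b != v by apply: contraNneq vt => <-; rewrite mem_cat inE eqxx orbT.
rewrite /is_chord evb mem_head inE mem_cat mem_head !orbT !next_nth mem_head.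
rewrite inE mem_cat mem_head !orbT /= eqxx (eq_sym v b) (negPf vb).
rewrite index_cat (negPf bt1) /= eqxx addn0.
apply/andP; split=> //.
  case: (t1) t10 bt1 => //= y t1' _; rewrite inE => /norP[]; by rewrite eq_sym.
apply: contraNneq vt => {1}->; apply: mem_nth.
by rewrite size_cat /=; case: (t2) t20 => //= *; lia.
Qed.

(** Otherwise cut the path at the first and the fourth neighbour of [v] and close it through [v]:
    the two neighbours in between give two chords at [v]. *)
Lemma path_nbr_count n (e : rel 'I_n) v s : symmetric e -> ~ contains_DCC1 e ->
  path.sorted e s -> uniq s -> v \notin s -> count (e v) s <= 3.
Proof.
move=> e_sym free e_s Us vs; rewrite leqNgt; apply/negP=> c4; apply: free.
have /count_gt0_split[s1 [a [s' [sE ea c3]]]] : 0 < count (e v) s by lia.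
have /count_gt0_split[s2 [b [s'' [s'E eb c2]]]] : 0 < count (e v) s' by lia.
have /count_gt0_split[s3 [d [s''' [s''E ed c1]]]] : 0 < count (e v) s'' by lia.
have /count_gt0_split[s4 [g [s5 [s'''E eg _]]]] : 0 < count (e v) s''' by lia.
pose t := a :: s2 ++ b :: s3 ++ d :: rcons s4 g.
have tE : s = s1 ++ t ++ s5.
  by rewrite sE s'E s''E s'''E /t /= -catA /= -catA /= cat_rcons.
have Ut : uniq (v :: t).
  rewrite cons_uniq; move: Us vs; rewrite tE cat_uniq => /and3P[_ _].
  rewrite cat_uniq => /andP[-> _]; rewrite mem_cat negb_or => /andP[_].
  by rewrite mem_cat negb_or => /andP[->].
have e_t : path e v t.
  move: e_s; rewrite tE sorted_cat_cons => /andP[_]; rewrite cat_path => /andP[].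
  by rewrite /= ea.
exists (v :: t); split=> //.
- by rewrite /t /= size_cat /= size_cat /=; lia.
- rewrite -[path.cycle e _]/(path e v (rcons t v)) rcons_path e_t /t /=.
  rewrite last_cat /= last_cat /= last_rcons.
  by rewrite e_sym.
exists v, b, d; split.
- apply: contraTneq Ut => bd; rewrite /t bd /= cat_uniq /= !mem_cat !inE eqxx.
  by rewrite !orbT /= !andbF.
- by apply: (@chord_of_cycle_head _ e v (a :: s2) b (s3 ++ d :: rcons s4 g)) => //; case: (s3).
have tE' : v :: t = v :: (a :: s2 ++ b :: s3) ++ d :: rcons s4 g by rewrite /t /= -catA.
by rewrite tE' in Ut *; apply: chord_of_cycle_head => //; case: (s4).
Qed.

(** * Sparsity of sets in which every cycle meets [N] at most twice *)

Section CycleSparse.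
Variables (T : finType) (e : rel T) (N : {set T}).
Hypotheses (e_sym : symmetric e) (e_irr : irreflexive e).
Implicit Types (S : {set T}) (s : seq T).

(** Edges inside [S] with one end in [N] count once, those with both ends in [N] twice. *)
Definition incidence S := \sum_(v in N :&: S) #|nbr e v :&: S|.

(** Lists of length at most two may also pass [path.cycle], but they satisfy the bound trivially. *)
Definition at_most_2_per_cycle S := forall c, uniq c -> path.cycle e c ->
  {subset c <= S} -> count [in N] c <= 2.

Let loss S v := (v \in N) * #|nbr e v :&: S| + #|nbr e v :&: S :&: N|.

Let incidenceD1 S v : v \in S -> incidence S = incidence (S :\ v) + loss S v.
Proof.
move=> vS; have nbrD1 : nbr e v :&: (S :\ v) = nbr e v :&: S.
  by apply/setP=> x; rewrite !inE; case: (x =P v) => // ->; rewrite e_irr.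
have -> : incidence S = \sum_(x in N :&: S) #|nbr e x :&: (S :\ v)|
                        + #|nbr e v :&: S :&: N|.
  rewrite -sum1_card [X in _ + X]big_mkcond /= [X in X + _]big_mkcond /=.
  rewrite -big_split /= /incidence big_mkcond; apply: eq_bigr => x _.
  rewrite !inE (e_sym v); case: (x \in N) => //=; last by rewrite andbF.
  case: (x \in S); rewrite ?andbF //= !andbT.
  rewrite (cardsD1 v) !inE vS andbT addnC; congr (_ + _).
  by rewrite setIDA.
rewrite /loss addnA; congr (_ + _).
case vN : (v \in N); last first.
  rewrite addn0; apply: eq_bigl => x; rewrite !inE.
  by case: (x =P v) => // ->; rewrite vN.
rewrite mul1n (bigD1 v) /=; last by rewrite inE vN vS.
rewrite nbrD1 addnC; congr (_ + _); apply: eq_bigl => x; rewrite !inE.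
by rewrite andbA andbAC.
Qed.

Section LongestPath.
Variable S : {set T}.
Hypotheses (S_cyc : at_most_2_per_cycle S).
Hypothesis (S_loss : forall v, v \in S -> 2 < loss S v).

(** Only these edges contribute to [incidence]. Along a path of such edges, one of any two
    consecutive vertices lies in [N]. *)
Let e' x y := e x y && ((x \in N) || (y \in N)).

Let e'_sym : symmetric e'.
Proof. by move=> x y; rewrite /e' e_sym orbC. Qed.

Let valid s := [&& uniq s, path.sorted e' s & all [in S] s].

Let longest s := valid s /\ forall s', valid s' -> size s' <= size s.

Let valid_size s : valid s -> size s <= #|S|.
Proof.
case/and3P=> Us _ /allP sS; rewrite -(card_uniqP Us).
by apply/subset_leq_card/subsetP.
Qed.

Let ex_longest v : v \in S -> exists v0 p, longest (v0 :: p).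
Proof.
move=> vS; pose P k := [exists t : k.-tuple T, valid t].
have P1 : P 1 by apply/existsP; exists [tuple v]; rewrite /valid /= vS.
have Pb k : P k -> k <= #|S| by case/existsP=> t /valid_size; rewrite size_tuple.
have [k /existsP[t vt] kmax] := ex_maxnP (ex_intro _ 1 P1) Pb.
have {}kmax s' : valid s' -> size s' <= k.
  by move=> vs'; apply: kmax; apply/existsP; exists (in_tuple s').
have [v0 [p tE]] : exists v0 p, tval t = v0 :: p.
  case: t vt => -[|v0 p] tk _; last by exists v0, p.
  have := kmax [:: v]; rewrite /valid /= vS => /(_ isT).
  by move/eqP: (tk) => <-.
by exists v0, p; rewrite -tE; split=> // s' /kmax; rewrite size_tuple.
Qed.

Let nbr_on_path v0 p x : longest (v0 :: p) -> x \in S -> e' v0 x -> x \in p.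
Proof.
move=> [vs smax] xS ex; apply: contraT => xp.
have := smax (x :: v0 :: p); rewrite ltnn; apply.
move: vs; rewrite /valid /= => /and3P[-> -> ->]; rewrite xS e'_sym ex inE negb_or xp.
by rewrite !andbT; apply: contraTneq ex => ->; rewrite /e' e_irr.
Qed.

(** Rotation in the sense of Posa: the edge from [v0] to [y] allows the initial segment to be
    reversed, so that the predecessor of [y] becomes the head. *)
Let longest_rot v0 p1 y p2 : longest (v0 :: p1 ++ y :: p2) -> e' v0 y ->
  longest (rev (v0 :: p1) ++ y :: p2).
Proof.
rewrite -cat_cons => -[vs smax] ey; split; last first.
  by move=> s' /smax; rewrite !size_cat size_rev.
move: vs; rewrite /valid => /and3P[Us ss aS]; apply/and3P; split.
- by rewrite (perm_uniq (s2 := (v0 :: p1) ++ y :: p2)) // perm_cat2r perm_rev.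
- move: ss; rewrite !sorted_cat_cons => /andP[s1 ->]; rewrite andbT.
  rewrite rev_cons -cats1 -cats1 -catA sorted_cat_cons /= ey andbT -rev_cons rev_sorted.
  move: s1; rewrite -cats1 /= cat_path => /andP[pp _].
  by rewrite (eq_path (e' := e')) ?andbT // => a b; apply: e'_sym.
by rewrite all_cat all_rev -all_cat.
Qed.

Let path_cycle v0 p1 y p2 : longest (v0 :: p1 ++ y :: p2) -> e' v0 y ->
  count [in N] (v0 :: rcons p1 y) <= 2.
Proof.
rewrite -cat_rcons -cat_cons => -[/and3P[Us ss aS] _] ey; apply: S_cyc.
- by move: Us; rewrite cat_uniq => /andP[].
- rewrite /= rcons_path last_rcons; case/andP: ey; rewrite e_sym => -> _.
  move: ss; rewrite /= cat_path => /andP[+ _]; rewrite andbT.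
  by apply: sub_path => a b /andP[].
by move=> x xs; apply: (allP aS); rewrite mem_cat xs.
Qed.

(** A head outside [N] would by [S_loss] have three neighbours in [N], all on the path by
    maximality. The cycle closed at the third of them would meet [N] three times. *)
Let headN v0 p : longest (v0 :: p) -> v0 \in N.
Proof.
move=> lo; apply: contraT => v0N.
have v0S : v0 \in S by case: lo => /and3P[_ _ /=/andP[]].
have := S_loss v0S; rewrite /loss (negPf v0N) mul0n add0n => c3.
pose q x := e v0 x && (x \in N).
have {}c3 : 2 < count q p.
  apply: leq_trans c3 _; rewrite -size_filter cardE.
  apply: uniq_leq_size; first exact: enum_uniq.
  move=> x; rewrite mem_enum mem_filter !inE => /andP[/andP[ex xS] xN].
  by rewrite /q ex xN /=; apply: nbr_on_path lo xS _; rewrite /e' ex xN orbT.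
have /count_gt0_split[p1 [a [p' [pE /andP[_ aN] c2]]]] : 0 < count q p by lia.
have /count_gt0_split[p2 [b [p'' [p'E /andP[_ bN] c1]]]] : 0 < count q p' by lia.
have /count_gt0_split[p3 [c [p4 [p''E /andP[ec cN] _]]]] : 0 < count q p'' by lia.
have := @path_cycle v0 (p1 ++ a :: p2 ++ b :: p3) c p4.
rewrite -catA /= -catA /= -p''E -p'E -pE => /(_ lo).
rewrite /e' ec cN orbT => /(_ isT).
by rewrite -cats1 count_cat /= count_cat /= count_cat /= aN bN cN; lia.
Qed.

Let prevN v0 p1 y p2 : longest (v0 :: p1 ++ y :: p2) -> e v0 y -> last v0 p1 \in N.
Proof.
move=> lo ey; have v0N := headN lo.
have := longest_rot lo; rewrite /e' ey v0N => /(_ isT).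
by rewrite lastI rev_rcons => /headN.
Qed.

(** Let [y] be a neighbour of [v0] on the path. Both [v0] and the predecessor of [y] lie in [N], as
    does one of any two consecutive vertices, and the cycle closed at [y] meets [N] at most twice.
    Hence [y] is among the first three vertices after [v0], and [loss > 2] leaves a single
    configuration. *)
Let head_nbrs v0 p : longest (v0 :: p) -> exists v1 v2 p',
  [/\ p = v1 :: v2 :: p', v1 \in N, v2 \notin N & nbr e v0 :&: S = [set v1; v2]].
Proof.
move=> lo; have v0N := headN lo.
have v0S : v0 \in S by case: lo => /and3P[_ _ /=/andP[]].
have := S_loss v0S; rewrite /loss v0N mul1n => c3.
have nbrP y : y \in nbr e v0 :&: S -> [\/ y = nth v0 p 0,
    [/\ y = nth v0 p 1, nth v0 p 0 \in N, y \notin N & 1 < size p]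
    | [/\ y = nth v0 p 2, nth v0 p 0 \notin N & y \notin N]].
  rewrite !inE => /andP[ey yS].
  have yp : y \in p by apply: nbr_on_path lo yS _; rewrite /e' ey v0N.
  move: lo; case/splitPr: p / yp => p1 p2 lo.
  have : count [in N] (v0 :: rcons p1 y) <= 2.
    by apply: path_cycle lo _; rewrite /e' ey v0N.
  have := prevN lo ey; have [/and3P[_ + _] _] := lo.
  rewrite -cats1 /= count_cat v0N /=.
  case: p1 {lo} => [|v1 [|v2 [|v3 p1]]] /=; first by constructor 1.
  - by move=> _ v1N; rewrite v1N => c2; constructor 2; split=> //; case: (y \in N) c2; lia.
  - move=> _ v2N; rewrite v2N => c2; constructor 3.
    by split=> //; [case: (v1 \in N) c2 | case: (y \in N) c2]; lia.
  case/and3P=> _ /andP[_ v12] _ lN.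
  have : 0 < count [in N] (v3 :: p1).
    by rewrite -has_count; apply/hasP; exists (last v3 p1); rewrite ?mem_last.
  by case/orP: v12 => -> /=; lia.
have le_loss := subset_leq_card (subsetIl (nbr e v0 :&: S) N).
have [v1N|v1N] := boolP (nth v0 p 0 \in N); last first.
  have : #|nbr e v0 :&: S :&: N| <= 0.
    rewrite leqn0 cards_eq0; apply/set0Pn=> -[y /setIP[/nbrP[->|[]|[]]]]; rewrite ?(negPf v1N) //.
    by move=> _ _ /negPf->.
  have : #|nbr e v0 :&: S| <= #|[set nth v0 p 0; nth v0 p 2]|.
    apply/subset_leq_card/subsetP=> y /nbrP[->|[_]|[->]]; rewrite !inE ?eqxx ?orbT //.
    by rewrite (negPf v1N).
  rewrite cards2; lia.
have nbr_sub : nbr e v0 :&: S \subset [set nth v0 p 0; nth v0 p 1].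
  apply/subsetP=> y /nbrP[->|[->]|[_]]; rewrite !inE ?eqxx ?orbT //.
  by rewrite v1N.
have [|v2n] := boolP (nth v0 p 1 \in nbr e v0 :&: S); last first.
  have : #|nbr e v0 :&: S| <= #|[set nth v0 p 0]|.
    apply/subset_leq_card/subsetP=> y yn.
    have := subsetP nbr_sub y yn; rewrite !inE => /orP[//|/eqP y1].
    by move: v2n; rewrite -y1 yn.
  by rewrite cards1; lia.
move=> v2n; have [v21|[_ _ v2N p1]|[_ + _]] := nbrP _ v2n; last by rewrite v1N.
  have : #|nbr e v0 :&: S| <= #|[set nth v0 p 0]|.
    by apply: leq_trans (subset_leq_card nbr_sub) _; rewrite v21 setUid.
  by rewrite cards1; lia.
case: p lo v1N v2N p1 nbr_sub c3 v2n {nbrP} => [|v1 [|v2 p']] //= lo v1N v2N _ nbr_sub c3 v2n.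
exists v1, v2, p'; split=> //; apply/eqP; rewrite eqEsubset nbr_sub /=.
apply/subsetP=> y; rewrite in_set2 => /orP[]/eqP-> //.
apply: contraT => v1n.
  have : #|nbr e v0 :&: S| <= #|[set v2]|.
    apply/subset_leq_card/subsetP=> x xn.
    have := subsetP nbr_sub x xn; rewrite !inE => /orP[/eqP x1|//].
    by move: v1n; rewrite -x1 xn.
  by rewrite cards1; lia.
Qed.

(** Rotating at the third vertex of the path exchanges its first two vertices, so [head_nbrs]
    applies to both of them. *)
Lemma pendant_triangle v : v \in S -> exists x y z,
  [/\ x != y, x \in N, y \in N, nbr e x :&: S = [set y; z] & nbr e y :&: S = [set x; z]]
  /\ z \notin N.
Proof.
case/ex_longest=> v0 [p lo].
have v0N := headN lo; have [v1 [v2 [p' [pE v1N v2N n0]]]] := head_nbrs lo.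
rewrite {p}pE in lo; exists v0, v1, v2; split=> //; split=> //.
  by case: lo => /and3P[/= /andP[+ _] _ _] _; rewrite inE negb_or => /andP[].
have /setIP[] : v2 \in nbr e v0 :&: S by rewrite n0 !inE eqxx orbT.
rewrite in_nbr => e02 _.
have := @longest_rot v0 [:: v1] v2 p' lo; rewrite /e' e02 v0N => /(_ isT).
by case/head_nbrs=> x [y [p'' [[<- <- _] _ _]]].
Qed.
End LongestPath.

(* Minimal counterexample: edges outside [N] may be ignored, and every vertex has
   [loss > 2], since otherwise it could be deleted.  The endpoint of a longest path
   lies in [N], and so does the predecessor of each of its neighbours on the path,
   this being the endpoint of the rotated path.  As no cycle meets [N] three times,
   the first two vertices of the path form a triangle with the third that is attached
   to the rest at the third only, and both can be deleted at once. *)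
Theorem incidence_bound S : S != set0 -> at_most_2_per_cycle S ->
  incidence S + 2 <= 2 * #|S|.
Proof.
have [m] := ubnP #|S|; elim: m S => // m IHm S; rewrite ltnS => leSm S0 S_cyc.
have sub_cyc (S' : {set T}) : S' \subset S -> at_most_2_per_cycle S'.
  by move=> S'S c Uc ec cS; apply: S_cyc => // x /cS; apply/subsetP.
have [/cards1P[v ->]|S1] := boolP (#|S| == 1).
  rewrite cards1 /incidence big1 // => x; rewrite !inE => /andP[_ /eqP->].
  apply/eqP; rewrite cards_eq0; apply/set0Pn=> -[y]; rewrite !inE.
  by case/andP=> + /eqP yv; rewrite yv e_irr.
have {}S1 : 1 < #|S| by move: S0 S1; rewrite -card_gt0; lia.
have [/existsP[v /andP[vS lv]]|/existsPn S_loss] :=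
  boolP [exists v, (v \in S) && (loss S v <= 2)].
  have := cardsD1 v S; rewrite vS => cS.
  have := IHm (S :\ v); rewrite (incidenceD1 vS) => /(_ _ _ (sub_cyc _ (subsetDl _ _))).
  by rewrite -card_gt0; lia.
have {}S_loss v : v \in S -> 2 < loss S v.
  by move=> vS; have := S_loss v; rewrite vS -ltnNge.
have [w wS] := set0Pn _ S0.
have [x [y [z [[xy xN yN nx ny] zN]]]] := pendant_triangle S_cyc S_loss wS.
have memS a b c : nbr e a :&: S = [set b; c] -> b \in S /\ c \in S.
  move=> nE; have /setIP[_ ->] : b \in nbr e a :&: S by rewrite nE !inE eqxx.
  by have /setIP[_ ->] : c \in nbr e a :&: S by rewrite nE !inE eqxx orbT.
have [yS zS] := memS _ _ _ nx; have [xS _] := memS _ _ _ ny.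
have zx : z != x by apply: contraNneq zN => ->.
have zy : z != y by apply: contraNneq zN => ->.
have := IHm (S :\ x :\ y).
have := cardsD1 x S; have := cardsD1 y (S :\ x); rewrite xS !inE eq_sym xy yS => /= c1 c2.
have -> : S :\ x :\ y != set0.
  by apply/set0Pn; exists z; rewrite !inE zx zy.
have ySx : y \in S :\ x by rewrite !inE eq_sym xy.
rewrite (incidenceD1 xS) (incidenceD1 ySx).
have Sxy : S :\ x :\ y \subset S by rewrite (subset_trans (subsetDl _ _)) ?subsetDl.
move=> /(_ _ isT (sub_cyc _ Sxy)).
(* The two deletions lose 3 and 1, together the 4 by which the right-hand side drops. *)
have -> : loss S x = 3.
  rewrite /loss xN nx mul1n cards2 eq_sym zy.
  have -> : [set y; z] :&: N = [set y].
    apply/setP=> t; rewrite !inE; case: (t =P y) => [->|_]; rewrite ?yN //=.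
    by case: (t =P z) => // ->; rewrite (negPf zN).
  by rewrite cards1.
have -> : loss (S :\ x) y = 1.
  rewrite /loss yN mul1n.
  have -> : nbr e y :&: (S :\ x) = [set z].
    rewrite setIDA ny; apply/setP=> t; rewrite !inE.
    by case: (t =P x) => [->|]//=; rewrite eq_sym (negPf zx).
  rewrite cards1 (_ : _ :&: N = set0) ?cards0 //.
  by apply/setP=> t; rewrite !inE; case: (t =P z) => // ->; rewrite (negPf zN).
move: c1 c2 leSm; clear.
move: (incidence _) #|S :\ x :\ y| #|S :\ x| #|S|; lia.
Qed.
End CycleSparse.

(** * Components of the graph minus a vertex *)

Section Attach.
Variables (T : finType) (e : rel T) (N : {set T}).
Hypothesis e_sym : symmetric e.

(* Every vertex of [C] starts a path inside [C] meeting [N] at least [k] times. *)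
Definition spread k (C : {set T}) := forall z, z \in C -> exists p,
  [/\ path e z p, uniq (z :: p), {subset z :: p <= C} & k <= count [in N] (z :: p)].

Lemma spread1 x : x \in N -> spread 1 [set x].
Proof.
move=> xN z /set1P->; exists [::]; split=> //=; last by rewrite xN.
by move=> y; rewrite !inE.
Qed.

Lemma spread_cycle c : uniq c -> path.cycle e c -> spread (count [in N] c) [set x in c].
Proof.
move=> Uc ec z; rewrite inE => zc; have [i p cE] := rot_to zc.
exists p; rewrite -cE rot_uniq; split=> //.
- by move: ec; rewrite -(rot_cycle i) cE /= rcons_path => /andP[].
- by move=> y; rewrite mem_rot inE.
by rewrite (seq.permP (permEl (perm_rot i c))).
Qed.

(** By induction the connecting path is shortened until its interior avoids [C1] and [C2]. A path
    inside [C1] read backwards, this interior and a path inside [C2] then concatenate to one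
    path. *)
Lemma spread_path (C1 C2 : {set T}) k1 k2 x1 x2 : spread k1 C1 -> spread k2 C2 ->
  [disjoint C1 & C2] -> x1 \in C1 -> x2 \in C2 -> connect e x1 x2 ->
  exists s, [/\ path.sorted e s, uniq s & k1 + k2 <= count [in N] s].
Proof.
move=> sp1 sp2 dis + + /connectP[p0 /shortenP[p pe Up _ {p0}]].
move=> + + x2E; rewrite {}x2E {x2}.
have [m] := ubnP (size p); elim: m x1 p pe Up => // m IHm x1 p pe Up.
rewrite ltnS => leqm x1C lC.
have [/hasP[y yp yC]|noC1] := boolP (has [in C1] p).
  case/splitPr: p / yp pe Up leqm lC => p1 p2.
  rewrite cat_path /= => /and3P[_ _ pe2] Up.
  rewrite last_cat size_cat /= => leqm lC; apply: IHm pe2 _ _ yC lC.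
    by case/andP: Up => _; rewrite cat_uniq => /and3P[].
  exact: leq_trans (leq_addl _ _) leqm.
case/lastP: p pe Up leqm lC noC1 => [|p y] pe Up leqm.
  by move=> x1C2; have := disjointFr dis x1C; rewrite x1C2.
rewrite last_rcons => yC noC1.
have [/hasP[z zp zC]|noC2] := boolP (has [in C2] p).
  case/splitPr: p / zp pe Up leqm noC1 => p1 p2 pe Up leqm noC1.
  apply: (IHm x1 (rcons p1 z)) => //.
  - by move: pe; rewrite rcons_cat rcons_cons -cat_rcons cat_path => /andP[].
  - by move: Up; rewrite rcons_cat rcons_cons -cat_rcons -cat_cons cat_uniq => /andP[].
  - by apply: leq_trans leqm; rewrite !size_rcons size_cat /= addnS !ltnS leq_addr.
  by rewrite last_rcons.
have [q1 [pe1 U1 s1 c1]] := sp1 _ x1C; have [q2 [pe2 U2 s2 c2]] := sp2 _ yC.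
exists (rev (x1 :: q1) ++ p ++ y :: q2); split.
- rewrite rev_cons -cats1 -catA cat1s sorted_cat_cons -rev_cons rev_sorted.
  rewrite (eq_sorted (e' := e)) => [|a b]; last exact: e_sym.
  by rewrite /= pe1 -cat_rcons cat_path pe last_rcons pe2.
- have Up' : uniq p by move: Up; rewrite /= rcons_uniq => /and3P[].
  have d2 : ~~ has [in p] (y :: q2).
    by apply/hasPn=> a /s2 aC2; apply: contra noC2 => ap; apply/hasP; exists a.
  rewrite cat_uniq rev_uniq U1 cat_uniq Up' d2 U2 /= andbT.
  apply/hasPn=> a; rewrite mem_cat /= mem_rev; apply: contraL => /[dup] aq /s1 aC1.
  apply/norP; split; last by apply/negP=> /s2; rewrite (disjointFr dis aC1).
  apply: contra noC1 => ap; apply/hasP; exists a => //.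
  by rewrite mem_rcons inE ap orbT.
by rewrite !count_cat count_rev leq_add // (leq_trans c2) // leq_addl.
Qed.
End Attach.

Lemma leq_sum_slack (I : finType) (P : {set I}) (F G : I -> nat) i0 k :
  (forall i, i \in P -> F i <= G i) -> i0 \in P -> F i0 + k <= G i0 ->
  \sum_(i in P) F i + k <= \sum_(i in P) G i.
Proof.
move=> FG Pi0 FG0; rewrite (bigD1 i0) //= [leqRHS](bigD1 i0) //= addnAC.
by apply: leq_add => //; apply: leq_sum => i /andP[/FG].
Qed.

Section Components.
Variables (n : nat) (e : rel 'I_n).
Hypotheses (e_sym : symmetric e) (e_irr : irreflexive e).
Hypothesis free : ~ contains_DCC1 e.
Variable u : 'I_n.

Notation N := (nbr e u).

Definition avoid (x y : 'I_n) := [&& e x y, x != u & y != u].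

Arguments avoid : simpl never.

Definition components : {set {set 'I_n}} := equivalence_partition (connect avoid) (~: [set u]).

Let avoid_sym : symmetric avoid.
Proof. by move=> x y; rewrite /avoid e_sym [X in _ && X]andbC. Qed.

(** A path for [avoid] containing [u] consists of [u] alone; to any other path [path_nbr_count]
    applies. *)
Lemma avoid_path_count s : path.sorted avoid s -> uniq s -> count [in N] s <= 3.
Proof.
move=> ss Us; have [us|us] := boolP (u \in s); last first.
  rewrite (eq_count (a2 := e u)) => [|x]; last by rewrite in_nbr.
  by apply: path_nbr_count => //; apply: sub_sorted ss => x y /and3P[].
case/splitPr: s / us ss Us => s1 s2.
rewrite sorted_cat_cons => /andP[ss1 ss2] _.
have -> : s2 = [::] by case: s2 ss2 => //= y s2; rewrite /avoid eqxx andbF.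
case/lastP: s1 ss1 => [|s1 y]; first by move=> _; rewrite /=; case: (u \in N).
by rewrite -!cats1 -catA cat1s sorted_cat_cons /= /avoid eqxx !andbF.
Qed.

Let components_partition : partition components (~: [set u]).
Proof.
apply: equivalence_partitionP => x y z _ _ _; split; first exact: connect0.
move=> xy; apply/idP/idP; last by apply: connect_trans.
by apply: connect_trans; rewrite (sym_connect_sym avoid_sym).
Qed.

Lemma componentP (D : {set 'I_n}) : D \in components -> [/\ u \notin D, D != set0,
  forall x y, x \in D -> y != u -> e x y -> y \in D &
  forall x y, x \in D -> y \in D -> connect avoid x y].
Proof.
move=> DP; have /and3P[/eqP covP _ P0] := components_partition.
case/imsetP: (DP) => x; rewrite !inE => xu DE.
have uD y : y \in D -> y != u by rewrite DE !inE => /andP[].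
split.
- by apply/negP=> /uD; rewrite eqxx.
- by apply: contraNneq P0 => <-.
- move=> y z /[dup] /uD yu; rewrite DE !inE => /andP[_ xy] zu eyz.
  by rewrite zu (connect_trans xy) // connect1 // /avoid eyz yu.
move=> y z; rewrite DE !inE => /andP[_ xy] /andP[_]; apply: connect_trans.
by rewrite (sym_connect_sym avoid_sym).
Qed.

Lemma component_of (x : 'I_n) : x != u -> exists2 D : {set 'I_n}, D \in components & x \in D.
Proof.
move=> xu; have /and3P[/eqP covP _ _] := components_partition.
have : x \in cover components by rewrite covP !inE.
by case/bigcupP=> D; exists D.
Qed.

Lemma sum_components (F : 'I_n -> nat) :
  \sum_(x | x != u) F x = \sum_(D in components) \sum_(x in D) F x.
Proof.
rewrite -(set_partition_big _ components_partition).
by apply: eq_bigl => x; rewrite !inE.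
Qed.

Lemma sum_card_components : \sum_(D in components) #|D| = n.-1.
Proof.
transitivity (\sum_(x | x != u) 1).
  by rewrite sum_components; apply: eq_bigr => D _; rewrite sum1_card.
by rewrite (eq_bigl [in predC1 u]) // sum1_card cardC1 card_ord.
Qed.

Lemma u_notin_N : u \notin N.
Proof. by rewrite in_nbr e_irr. Qed.

Lemma degree_components : #|N| = \sum_(D in components) #|N :&: D|.
Proof.
rewrite -sum1_card big_mkcond (bigD1 u) //= (negPf u_notin_N) add0n sum_components.
apply: eq_bigr => D _; rewrite -sum1_card -big_mkcondr; apply: eq_bigl => x.
by rewrite in_setI andbC.
Qed.

(** A neighbour of [u] has [u] itself as one neighbour, and all its others lie in its own
    component. *)
Lemma walks2_components :
  walks2 e u = \sum_(D in components) (#|N :&: D| + incidence e N D).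
Proof.
rewrite /walks2 big_mkcond (bigD1 u) //= (negPf u_notin_N) add0n sum_components.
apply: eq_bigr => D DP; have [uD _ Dcl _] := componentP DP.
rewrite -sum1_card -big_split /= [RHS]big_mkcond /= [LHS]big_mkcond /=.
apply: eq_bigr => x _; rewrite in_setI in_nbr; case xD: (x \in D); last by rewrite andbF.
case ux: (e u x) => //=; rewrite (cardsD1 u) in_nbr e_sym ux; congr addn.
apply: eq_card => y; rewrite !inE andbC; case exy: (e x y) => //=.
apply/idP/idP=> [yu|]; last by apply: contraTneq => ->.
exact: Dcl xD yu exy.
Qed.

(* A cycle through three neighbours of [u] in a component containing a fourth one
   extends to a path through all four. *)
Lemma component_incidence (D : {set 'I_n}) : D \in components -> #|N :&: D| != 3 ->
  incidence e N D + 2 <= 2 * #|D|.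
Proof.
move=> DP a3; have [uD D0 Dcl Dco] := componentP DP.
apply: incidence_bound => // c Uc ec cD; rewrite leqNgt; apply/negP=> c3.
have ac : path.cycle avoid c.
  apply: (sub_in_cycle (P := [in D]) _ _ ec); last exact/allP.
  move=> y z yD zD eyz; rewrite /avoid eyz.
  by rewrite !(memPn uD).
have cN : count [in N] c = #|N :&: [set x in c]|.
  rewrite -size_filter -(card_uniqP (filter_uniq _ Uc)).
  by apply: eq_card => x; rewrite !inE mem_filter inE.
have cle3 : count [in N] c <= 3.
  apply: avoid_path_count => //; case: c ac {Uc ec cD c3 cN} => //= x c.
  by rewrite rcons_path => /andP[].
(* The cycle meets [N] exactly three times; if it contained all of [N :&: D], that set would have
   three elements. *)
have : ~~ (N :&: D \subset [set x in c]).
  apply: contra a3 => Dc; rewrite eqn_leq; apply/andP; split.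
    rewrite (leq_trans _ cle3) // cN subset_leq_card // subsetI subsetIl.
    exact: Dc.
  rewrite (leq_trans c3) // cN subset_leq_card // setIS //.
  by apply/subsetP=> x; rewrite inE; apply: cD.
case/subsetPn=> x /setIP[xN xD]; rewrite inE => xc.
have [z zc] : exists z, z \in c by case: (c) c3 => // z ? _; exists z; rewrite mem_head.
have [||||s [ss Us]] := spread_path avoid_sym (spread_cycle N Uc ac)
  (spread1 avoid xN) (x1 := z) (x2 := x).
- by rewrite disjoint_sym disjoints1 inE.
- by rewrite inE.
- by rewrite inE.
- exact: Dco (cD _ zc) xD.
move=> c4; have := leq_trans c4 (avoid_path_count ss Us).
by rewrite addn1 leqNgt ltnS c3.
Qed.
End Components.

(** * Edges from three neighbours of a vertex to other vertices *)

Section Triples.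
Variables (n : nat) (e : rel 'I_n).
Hypotheses (e_sym : symmetric e) (e_irr : irreflexive e).
Hypothesis free : ~ contains_DCC1 e.

Lemma no_fan v s : path.sorted e s -> uniq s -> v \notin s -> 3 < count (e v) s -> False.
Proof. by move=> ss Us vs; rewrite ltnNge path_nbr_count. Qed.

Lemma adj_neq x y : e x y -> x != y.
Proof. by apply: contraTneq => ->; rewrite e_irr. Qed.

(** The path [w, v2, v3, v4] consists of neighbours of [v1]. *)
Lemma K4_no_extension v1 v2 v3 v4 w : e v1 v2 -> e v1 v3 -> e v1 v4 -> e v2 v3 ->
  e v3 v4 -> e v1 w -> e v2 w -> w != v3 -> w != v4 -> v2 != v4 -> False.
Proof.
move=> e12 e13 e14 e23 e34 e1w e2w w3 w4 n24.
have w2 : w != v2 by rewrite eq_sym adj_neq.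
apply: (@no_fan v1 [:: w; v2; v3; v4]).
- by rewrite /= (e_sym w) e2w e23 e34.
- rewrite /= !inE (negPf w2) (negPf w3) (negPf w4) (negPf n24).
  by rewrite (negPf (adj_neq e23)) (negPf (adj_neq e34)).
- by rewrite !inE !negb_or !adj_neq.
by rewrite /= e12 e13 e14 e1w.
Qed.

Variables (u n1 n2 n3 : 'I_n).
Hypotheses (eu1 : e u n1) (eu2 : e u n2) (eu3 : e u n3).
Hypotheses (n12 : n1 != n2) (n13 : n1 != n3) (n23 : n2 != n3).
Variable B : {set 'I_n}.
Hypotheses (uB : u \notin B) (n1B : n1 \notin B) (n2B : n2 \notin B) (n3B : n3 \notin B).

Definition links a b c (C : {set 'I_n}) := #|nbr e a :&: C| + #|nbr e b :&: C| + #|nbr e c :&: C|.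

Let k w := e n1 w + e n2 w + e n3 w.

Let linksE : links n1 n2 n3 B = \sum_(w in B) k w.
Proof.
rewrite !big_split /= /links; congr (_ + _ + _).
all: rewrite -sum1_card big_mkcond [RHS]big_mkcond; apply: eq_bigr => w _.
all: by rewrite !inE andbC; case: (w \in B) => //=; case: (e _ w).
Qed.

Let neqB w : w \in B -> [/\ w != u, w != n1, w != n2 & w != n3].
Proof. by move=> wB; split; apply: contraTneq wB => ->. Qed.

Lemma links_le3 : links n1 n2 n3 B <= 3 * #|B|.
Proof.
rewrite linksE mulnC -sum_nat_const; apply: leq_sum => w _.
by rewrite /k; case: (e n1 w); case: (e n2 w); case: (e n3 w).
Qed.

(** With [u] the triple forms a K_4, and no outside vertex sees two of its vertices. *)
Lemma links_triangle : e n1 n2 -> e n2 n3 -> e n1 n3 -> links n1 n2 n3 B <= #|B|.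
Proof.
move=> e12 e23 e13; rewrite linksE -sum1_card; apply: leq_sum => w /neqB[wu w1 w2 w3].
have := adj_neq eu1; have := adj_neq eu2; have := adj_neq eu3.
rewrite 3!(eq_sym u) => nu3 nu2 nu1; rewrite /k.
move: (eu1) (eu2) (eu3) (e12) (e23) (e13); rewrite 3!(e_sym u).
move=> e1u e2u e3u; rewrite (e_sym n1) (e_sym n2 n3) (e_sym n1 n3) => e21 e32 e31.
case e1: (e n1 w); case e2: (e n2 w); case e3: (e n3 w) => //; exfalso.
- exact: (@K4_no_extension n1 n2 n3 u w).
- exact: (@K4_no_extension n1 n2 n3 u w).
- exact: (@K4_no_extension n1 n3 n2 u w).
exact: (@K4_no_extension n2 n3 n1 u w).
Qed.

(** A vertex [w] adjacent to all three would give the path [n1, u, n3, w] of neighbours of [n2]. *)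
Lemma links_path : e n1 n2 -> e n2 n3 -> links n1 n2 n3 B <= 2 * #|B|.
Proof.
move=> e12 e23; rewrite linksE mulnC -sum_nat_const; apply: leq_sum => w /neqB[wu w1 w2 w3].
rewrite /k; case e1: (e n1 w); case e2: (e n2 w); case e3: (e n3 w) => //; exfalso.
apply: (@no_fan n2 [:: n1; u; n3; w]).
- by rewrite /= (e_sym n1) eu1 eu3 e3.
- rewrite /= !inE !negb_or (eq_sym n1 u) (adj_neq eu1) n13 (eq_sym n1) w1 (adj_neq eu3).
  by rewrite (eq_sym u) wu (eq_sym n3) w3.
- by rewrite !inE !negb_or eq_sym n12 (eq_sym n2 u) (adj_neq eu2) n23 eq_sym w2.
by rewrite /= (e_sym n2 n1) e12 (e_sym n2 u) eu2 e23 e2.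
Qed.

(** Only one vertex of [B] can see all three: with two of them, [w] and [w'], the path
    [u, n2, w, n3, w'] contains four neighbours of [n1]. *)
Lemma links_edge : e n1 n2 -> links n1 n2 n3 B <= 2 * #|B| + 1.
Proof.
move=> e12; rewrite linksE.
have kle w : k w <= 2 + (k w == 3).
  by rewrite /k; case: (e n1 w); case: (e n2 w); case: (e n3 w).
have le_sum : \sum_(w in B) k w <= \sum_(w in B) (2 + (k w == 3)) by apply: leq_sum.
apply: leq_trans le_sum _; rewrite big_split /= sum_nat_const mulnC leq_add2l.
rewrite -big_mkcondr /= sum1_card; apply/card_le1_eqP=> w w' /andP[wB kw] /andP[w'B kw'].
have [wu w1 w2 w3] := neqB wB; have [w'u w'1 w'2 w'3] := neqB w'B.
move: kw kw'; rewrite /k.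
case e1: (e n1 w); case e2: (e n2 w); case e3: (e n3 w) => // _.
case e1': (e n1 w'); case e2': (e n2 w'); case e3': (e n3 w') => // _.
apply/eqP; apply: contraT => ww'; exfalso.
apply: (@no_fan n1 [:: u; n2; w; n3; w']).
- by rewrite /= eu2 e2 (e_sym w) e3 e3'.
- rewrite /= !inE !negb_or (adj_neq eu2) (eq_sym u w) wu (adj_neq eu3) (eq_sym u w') w'u.
  by rewrite (adj_neq e2) n23 (adj_neq e2') w3 eq_sym ww' (adj_neq e3').
- by rewrite !inE !negb_or (eq_sym n1 u) (adj_neq eu1) n12 (adj_neq e1) n13 (adj_neq e1').
by rewrite /= (e_sym n1 u) eu1 e12 e1 e1'; case: (e n1 n3).
Qed.

(** At least five vertices of [B] see the whole triple, and [u] is a sixth common neighbour. *)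
Lemma links_common : 2 * #|B| + 5 <= links n1 n2 n3 B ->
  6 <= #|nbr e n1 :&: nbr e n2 :&: nbr e n3|.
Proof.
rewrite linksE => lk.
have kle w : k w <= 2 + (k w == 3).
  by rewrite /k; case: (e n1 w); case: (e n2 w); case: (e n3 w).
have le_sum : \sum_(w in B) k w <= \sum_(w in B) (2 + (k w == 3)) by apply: leq_sum.
have := leq_trans lk le_sum; rewrite big_split /= sum_nat_const mulnC leq_add2l.
rewrite -big_mkcondr /= sum1_card => c5.
rewrite (cardsD1 u) !inE (e_sym n1) eu1 (e_sym n2) eu2 (e_sym n3) eu3 /=.
rewrite add1n ltnS; apply: leq_trans c5 _; apply/subset_leq_card/subsetP=> w.
case/andP=> wB; rewrite /k !inE; have [-> _ _ _] := neqB wB.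
by case: (e n1 w); case: (e n2 w); case: (e n3 w).
Qed.
End Triples.

Lemma cards3_ex (T : finType) (A : {set T}) : #|A| = 3 ->
  exists a b c, [/\ a != b, a != c, b != c & A = [set a; b; c]].
Proof.
move=> A3; have /set0Pn[a aA] : A != set0 by rewrite -card_gt0 A3.
have c2 : #|A :\ a| == 2.
  by have := cardsD1 a A; rewrite aA A3; lia.
case/cards2P: c2 => b [c [bc AE]]; exists a, b, c.
have /setD1P[ba _] : b \in A :\ a by rewrite AE !inE eqxx.
have /setD1P[ca _] : c \in A :\ a by rewrite AE !inE eqxx orbT.
by rewrite -(setD1K aA) AE setUA; split=> //; rewrite eq_sym.
Qed.

Lemma big_set3 (T : finType) (a b c : T) (F : T -> nat) : a != b -> a != c -> b != c ->
  \sum_(x in [set a; b; c]) F x = F a + F b + F c.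
Proof.
move=> ab ac bc; rewrite -setUA big_setU1 ?big_setU1 ?big_set1 ?addnA ?inE //=.
  by rewrite addnA.
by rewrite negb_or ab.
Qed.

Section ComponentCases.
Variables (n : nat) (e : rel 'I_n).
Hypotheses (e_sym : symmetric e) (e_irr : irreflexive e).
Hypothesis free : ~ contains_DCC1 e.

Lemma card_nbr3 x a b c : a != b -> a != c -> b != c ->
  #|nbr e x :&: [set a; b; c]| = e x a + e x b + e x c.
Proof.
move=> ab ac bc; rewrite -sum1_card big_mkcond /=.
rewrite -(big_set3 (e x)) // [RHS]big_mkcond; apply: eq_bigr => y _ /=.
by rewrite in_setI in_nbr; case: (y \in [set a; b; c]); case: (e x y).
Qed.

Lemma incidence_set3 (N D : {set 'I_n}) a b c : a != b -> a != c -> b != c ->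
  N :&: D = [set a; b; c] ->
  incidence e N D = links e a b c (D :\: N) + 2 * (e a b + e a c + e b c).
Proof.
move=> ab ac bc NDE.
rewrite /incidence NDE big_set3 // /links.
have split x : #|nbr e x :&: D| = #|nbr e x :&: (D :\: N)| + #|nbr e x :&: [set a; b; c]|.
  by rewrite -NDE -(cardsID N) addnC setIDA setIAC setIA.
rewrite !split !card_nbr3 // !e_irr (e_sym b a) (e_sym c a) (e_sym c b); lia.
Qed.

Lemma links_swap12 a b c C : links e a b c C = links e b a c C.
Proof. by rewrite /links (addnC #|_|). Qed.

Lemma links_swap23 a b c C : links e a b c C = links e a c b C.
Proof. by rewrite /links addnAC. Qed.

Lemma links_bound u a b c (C : {set 'I_n}) : e u a -> e u b -> e u c ->
  a != b -> a != c -> b != c ->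
  u \notin C -> a \notin C -> b \notin C -> c \notin C ->
  links e a b c C <= match (e a b + e a c + e b c)%N with
    | 0 => 3 * #|C| | 1 => 2 * #|C| + 1 | 2 => 2 * #|C| | _ => #|C| end.
Proof.
move=> ua ub uc ab ac bc uC aC bC cC.
have [ba ca cb] : [/\ b != a, c != a & c != b] by rewrite eq_sym ab eq_sym ac eq_sym bc.
case eab: (e a b); case eac: (e a c); case ebc: (e b c) => /=.
- exact: (links_triangle e_sym e_irr free ua ub uc).
- by rewrite links_swap12; apply: (links_path e_sym e_irr free ub ua uc); rewrite // e_sym.
- exact: (links_path e_sym e_irr free ua ub uc).
- exact: (links_edge e_sym e_irr free ua ub uc).
- by rewrite links_swap23; apply: (links_path e_sym e_irr free ua uc ub); rewrite // e_sym.
- by rewrite links_swap23; apply: (links_edge e_sym e_irr free ua uc ub).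
- by rewrite links_swap12 links_swap23; apply: (links_edge e_sym e_irr free ub uc ua).
exact: links_le3.
Qed.

Definition has_K36 := exists x1 x2 x3 : 'I_n, [/\ x1 != x2, x1 != x3, x2 != x3 &
  6 <= #|nbr e x1 :&: nbr e x2 :&: nbr e x3|].

Variable u : 'I_n.
Notation N := (nbr e u).

(* The second case is a triangle of neighbours, the third an independent triple. *)
Lemma component_cases (D : {set 'I_n}) : D \in components e u ->
  [\/ incidence e N D + 2 <= 2 * #|D|,
      [/\ #|N :&: D| = 3, incidence e N D <= #|D| + 3
        & forall x, x \in N :&: D -> #|nbr e x :&: (N :&: D)| = 2]
    | [/\ #|N :&: D| = 3, incidence e N D + 9 <= 3 * #|D|
        & 2 * #|D| <= incidence e N D + 1 -> has_K36]].
Proof.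
move=> DP; have [a3|a3] := eqVneq #|N :&: D| 3; last first.
  by constructor 1; apply: component_incidence.
have [uD _ _ _] := componentP e_sym DP.
have [a [b [c [ab ac bc NDE]]]] := cards3_ex a3.
have cD : #|D| = 3 + #|D :\: N| by rewrite -(cardsID N D) setIC a3.
have inND x : x \in [set a; b; c] -> [/\ e u x, x \in D & x \notin D :\: N].
  by rewrite -NDE => /setIP[xN ->]; rewrite -in_nbr xN in_setD xN.
have [ua aD aB] : [/\ e u a, a \in D & a \notin D :\: N] by apply: inND; rewrite !inE eqxx.
have [ub bD bB] : [/\ e u b, b \in D & b \notin D :\: N] by apply: inND; rewrite !inE eqxx orbT.
have [uc cD' cB] : [/\ e u c, c \in D & c \notin D :\: N] by apply: inND; rewrite !inE eqxx orbT.
have uB : u \notin D :\: N by rewrite inE (negPf uD) andbF.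
have incE := incidence_set3 ab ac bc NDE.
have := links_bound ua ub uc ab ac bc uB aB bB cB; move: incE.
case E: (e a b + e a c + e b c)%N => [|[|[|k]]] incE le_links.
- constructor 3; split=> //.
    rewrite incE cD; move: le_links; clear.
    by move: (links e _ _ _ _) #|_ :\: _|; lia.
  (* Since [#|D|] is [3 + #|D :\: N|], the assumed incidence is exactly the threshold of
     [links_common]. *)
  move=> le_inc; exists a, b, c; split=> //.
  apply: (links_common e_sym ua ub uc uB) => //; move: le_inc; rewrite incE cD; clear.
  by move: (links e _ _ _ _) #|_ :\: _|; lia.
- constructor 1; rewrite incE cD; move: le_links; clear.
  by move: (links e _ _ _ _) #|_ :\: _|; lia.
- constructor 1; rewrite incE cD; move: le_links; clear.
  by move: (links e _ _ _ _) #|_ :\: _|; lia.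
move: E incE; case eab: (e a b); case eac: (e a c); case ebc: (e b c) => // -[<-] incE.
constructor 2; split=> //.
  rewrite incE cD; move: le_links; clear.
  by move: (links e _ _ _ _) #|_ :\: _|; lia.
move=> x; rewrite NDE card_nbr3 // !inE -orbA => /or3P[]/eqP->.
all: by rewrite ?e_irr ?(e_sym b a) ?(e_sym c a) ?(e_sym c b) ?eab ?eac ?ebc.
Qed.

End ComponentCases.

(** * Graphs containing $K_{3,6}$ *)

Lemma ex_notin (T : finType) (P : {set T}) (s : seq T) : size s < #|P| ->
  exists2 p, p \in P & p \notin s.
Proof.
move=> sP; have : ~~ (P \subset s).
  apply: contraL sP => Ps; rewrite -leqNgt.
  by apply: leq_trans (subset_leq_card Ps) (card_size s).
by case/subsetPn=> p; exists p.
Qed.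

Section K3m.
Variables (n : nat) (e : rel 'I_n).
Hypotheses (e_sym : symmetric e) (e_irr : irreflexive e).
Hypothesis free : ~ contains_DCC1 e.
Variables (x1 x2 x3 : 'I_n) (P : {set 'I_n}).
Hypotheses (x12 : x1 != x2) (x13 : x1 != x3) (x23 : x2 != x3).
Hypothesis inP : forall p, p \in P -> [/\ e x1 p, e x2 p & e x3 p].

Let neqP p : p \in P -> [/\ p != x1, p != x2 & p != x3].
Proof. by case/inP=> h1 h2 h3; rewrite ![p == _]eq_sym !(adj_neq e_irr). Qed.

(** With the edge, the path [p1, x2, p2, x3, p3] would contain four neighbours of [x1]. *)
Lemma K3m_hub_nonadj : 2 < #|P| -> ~~ e x1 x2.
Proof.
move=> P3; apply/negP=> e12.
have [p1 p1P _] : exists2 p, p \in P & p \notin [::] by apply: ex_notin; apply: leq_trans P3.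
have [p2 p2P] : exists2 p, p \in P & p \notin [:: p1] by apply: ex_notin; apply: leq_trans P3.
have [p3 p3P] : exists2 p, p \in P & p \notin [:: p1; p2] by apply: ex_notin.
rewrite !inE !negb_or => /andP[n31 n32] n21.
have [e11 e21 e31] := inP p1P; have [e12' e22 e32] := inP p2P; have [e13 e23 e33] := inP p3P.
have [h11 h12 h13] := neqP p1P; have [h21 h22 h23] := neqP p2P; have [h31 h32 h33] := neqP p3P.
apply: (@no_fan n e e_sym free x1 [:: p1; x2; p2; x3; p3]).
- by rewrite /= (e_sym p1) e21 e22 (e_sym p2) e32 e33.
- rewrite /= !inE !negb_or h12 (eq_sym p1 p2) n21 h13 (eq_sym p1 p3) n31.
  by rewrite (eq_sym x2 p2) h22 x23 (eq_sym x2 p3) h32 h23 (eq_sym p2 p3) n32 (eq_sym x3 p3) h33.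
- by rewrite !inE !negb_or x12 x13 !(adj_neq e_irr).
by rewrite /= e11 e12 e12' e13; case: (e x1 x3).
Qed.

(** Otherwise the path [v, p, x2, q, x3, r] contains four neighbours of [x1]. The vertex [v] may
    itself lie in [P], so [P] is independent. *)
Lemma K3m_leaf_nonadj v p : 3 < #|P| -> e x1 v -> v != x2 -> v != x3 -> p \in P -> ~~ e v p.
Proof.
move=> P4 e1v v2 v3 pP; apply/negP=> evp.
have [q qP] : exists2 q, q \in P & q \notin [:: v; p] by apply: ex_notin; apply: leq_trans P4.
rewrite !inE negb_or => /andP[qv qp].
have [r rP] : exists2 r, r \in P & r \notin [:: v; p; q] by apply: ex_notin.
rewrite !inE !negb_or => /and3P[rv rp rq].
have [e1p e2p e3p] := inP pP; have [e1q e2q e3q] := inP qP; have [e1r e2r e3r] := inP rP.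
have [p1 p2 p3] := neqP pP; have [q1 q2 q3] := neqP qP; have [r1 r2 r3] := neqP rP.
apply: (@no_fan n e e_sym free x1 [:: v; p; x2; q; x3; r]).
- by rewrite /= evp (e_sym p) e2p e2q (e_sym q) e3q e3r.
- rewrite /= !inE !negb_or (adj_neq e_irr evp) v2 (eq_sym v q) qv v3 (eq_sym v r) rv.
  rewrite p2 (eq_sym p q) qp p3 (eq_sym p r) rp (eq_sym x2 q) q2 x23 (eq_sym x2 r) r2.
  by rewrite q3 (eq_sym q r) rq (eq_sym x3 r) r3.
- by rewrite !inE !negb_or x12 x13 !(adj_neq e_irr).
by rewrite /= e1v e1p e1q e1r; case: (e x1 x2); case: (e x1 x3).
Qed.

(** If [p] and [q] differ, the path [r, x2, p, v, q, x3, s] contains four neighbours of [x1]. *)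
Lemma K3m_outside_nbr v p q : 4 < #|P| -> v != x1 -> v != x2 -> v != x3 ->
  p \in P -> q \in P -> e v p -> e v q -> p = q.
Proof.
move=> P5 v1 v2 v3 pP qP evp evq; apply/eqP/contraT => pq; exfalso.
have [r rP] : exists2 r, r \in P & r \notin [:: v; p; q] by apply: ex_notin; apply: leq_trans P5.
rewrite !inE !negb_or => /and3P[rv rp rq].
have [s sP] : exists2 s, s \in P & s \notin [:: v; p; q; r] by apply: ex_notin.
rewrite !inE !negb_or => /and4P[sv sp sq sr].
have [e1p e2p e3p] := inP pP; have [e1q e2q e3q] := inP qP; have [e1r e2r e3r] := inP rP.
have [e1s e2s e3s] := inP sP.
have [p1 p2 p3] := neqP pP; have [q1 q2 q3] := neqP qP; have [r1 r2 r3] := neqP rP.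
have [s1 s2 s3] := neqP sP.
apply: (@no_fan n e e_sym free x1 [:: r; x2; p; v; q; x3; s]).
- by rewrite /= (e_sym r) e2r e2p (e_sym p) evp evq (e_sym q) e3q e3s.
- rewrite /= !inE !negb_or r2 rp rv rq r3 (eq_sym r s) sr (eq_sym x2 p) p2 (eq_sym x2 v) v2.
  rewrite (eq_sym x2 q) q2 x23 (eq_sym x2 s) s2 (eq_sym p v) (adj_neq e_irr evp) pq p3 (eq_sym p s) sp.
  by rewrite (adj_neq e_irr evq) v3 (eq_sym v s) sv q3 (eq_sym q s) sq (eq_sym x3 s) s3.
- by rewrite !inE !negb_or x12 x13 (eq_sym x1 v) v1 !(adj_neq e_irr).
by rewrite /= e1p e1q e1r e1s; case: (e x1 x2); case: (e x1 x3); case: (e x1 v).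
Qed.

End K3m.

Section WalksK36.
Variables (n : nat) (e : rel 'I_n).
Hypotheses (e_sym : symmetric e) (e_irr : irreflexive e).
Hypothesis free : ~ contains_DCC1 e.

Lemma component_walks u (D : {set 'I_n}) : D \in components e u ->
  #|nbr e u :&: D| + incidence e (nbr e u) D <= 3 * #|D|.
Proof.
move=> /(component_cases e_sym e_irr free) cD.
have := cardsID (nbr e u) D; rewrite setIC.
case: cD => [|[+ + _]|[+ + _]]; move: (incidence _ _ _) #|_ :&: _| #|_ :\: _| #|D|; lia.
Qed.

(** In the sparse case the slack is 2 from the incidence plus 4 from the non-neighbours of [u]. *)
Lemma component_walks_slack u (D : {set 'I_n}) : D \in components e u ->
  4 <= #|D :\: nbr e u| ->
  #|nbr e u :&: D| + incidence e (nbr e u) D + 6 <= 3 * #|D|.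
Proof.
move=> /(component_cases e_sym e_irr free) cD.
have := cardsID (nbr e u) D; rewrite setIC.
case: cD => [|[+ + _]|[+ + _]]; move: (incidence _ _ _) #|_ :&: _| #|_ :\: _| #|D|; lia.
Qed.

(** The components together allow [3 * (n - 1)], so a slack of 6 in one of them gives
    [3 * n - 9]. *)
Lemma walks2_slack u (D : {set 'I_n}) : D \in components e u ->
  #|nbr e u :&: D| + incidence e (nbr e u) D + 6 <= 3 * #|D| ->
  walks2 e u + 9 <= 3 * n.
Proof.
move=> DP slackD.
have := leq_sum_slack (fun D' D'P => component_walks D'P) DP slackD.
rewrite -walks2_components // -big_distrr /= sum_card_components //.
have := ltn_ord u; lia.
Qed.

Section Fixed.
Variables (x1 x2 x3 : 'I_n) (P : {set 'I_n}).
Hypotheses (x12 : x1 != x2) (x13 : x1 != x3) (x23 : x2 != x3).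
Hypothesis inP : forall p, (p \in P) = [&& e x1 p, e x2 p & e x3 p].
Hypothesis P6 : 6 <= #|P|.

Let inP' p : p \in P -> [/\ e x1 p, e x2 p & e x3 p].
Proof. by rewrite inP => /and3P. Qed.

(** Of the six vertices of [P], at most one is a neighbour of [u] and one may be [u]. The other four
    are non-neighbours in the component of [x1]. *)
Lemma walks2_outside_hubs u : u != x1 -> u != x2 -> u != x3 -> walks2 e u + 9 <= 3 * n.
Proof.
move=> u1 u2 u3; have x1u : x1 != u by rewrite eq_sym.
have [D DP x1D] := component_of e_sym x1u.
have [_ _ Dcl _] := componentP e_sym DP.
apply: (walks2_slack DP); apply: component_walks_slack => //.
have PN1 : #|P :&: nbr e u| <= 1.
  apply/card_le1_eqP=> p q /setIP[pP]; rewrite in_nbr => up /setIP[qP]; rewrite in_nbr => uq.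
  symmetry; apply: (K3m_outside_nbr e_sym e_irr free x12 x13 x23 inP' _ u1 u2 u3 pP qP up uq).
  exact: leq_trans P6.
have : (P :\: nbr e u) :\ u \subset D :\: nbr e u.
  apply/subsetP=> p; rewrite !inE => /and3P[pu -> pP] /=.
  by apply: Dcl x1D pu _; case: (inP' pP).
move/subset_leq_card; apply: leq_trans.
have ar (a b c d : nat) (t : bool) : a <= 1 -> 6 <= c -> a + b = c -> b = t + d -> 4 <= d.
  by clear; case: t; lia.
exact: ar PN1 P6 (cardsID (nbr e u) P) (cardsD1 u (P :\: nbr e u)).
Qed.

(** One component [D] contains [P], [x2] and [x3]. If it has four non-neighbours of [x1], the slack
    is immediate. Otherwise at most one of them, forming [W], differs from [x2] and [x3]. Each
    neighbour of [x1] in [D] then has at most two neighbours in [D], up to a total excess of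
    [#|W|]. *)
Lemma walks2_at_hub : walks2 e x1 + 9 <= 3 * n.
Proof.
have P3 : 2 < #|P| by apply: leq_trans P6.
have P4 : 3 < #|P| by apply: leq_trans P6.
have P5 : 4 < #|P| by apply: leq_trans P6.
have n12 : ~~ e x1 x2 := K3m_hub_nonadj e_sym e_irr free x12 x13 x23 inP' P3.
have n13 : ~~ e x1 x3.
  by apply: (K3m_hub_nonadj e_sym e_irr free x13 x12 _ _ P3); rewrite 1?eq_sym // => p /inP'[].
have noP v p : e x1 v -> p \in P -> ~~ e v p.
  move=> e1v; apply: (K3m_leaf_nonadj e_sym e_irr free x12 x13 x23 inP' P4 e1v).
    by apply: contraNneq n12 => <-.
  by apply: contraNneq n13 => <-.
have neqP p : p \in P -> [/\ p != x1, p != x2 & p != x3].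
  by case/inP'=> h1 h2 h3; rewrite ![p == _]eq_sym !(adj_neq e_irr).
have x21 : x2 != x1 by rewrite eq_sym.
have x31 : x3 != x1 by rewrite eq_sym.
have [D DP x2D] := component_of e_sym x21.
have [x1D _ Dcl Dco] := componentP e_sym DP.
have PD p : p \in P -> p \in D.
  by move=> /[dup]/neqP[p1 _ _] /inP'[_ e2p _]; apply: Dcl x2D p1 e2p.
have x3D : x3 \in D.
  have [p pP _] : exists2 p, p \in P & p \notin [::] by apply: ex_notin; apply: leq_trans P3.
  by apply: (Dcl p) (PD _ pP) x31 _; rewrite e_sym; case: (inP' pP).
have [/(component_walks_slack DP)/(walks2_slack DP)//|] := leqP 4 #|D :\: nbr e x1|.
pose W := D :\: nbr e x1 :\ x2 :\ x3.
have cW : #|D :\: nbr e x1| = 2 + #|W|.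
  rewrite (cardsD1 x2) (cardsD1 x3) !inE n12 n13 x2D x3D eq_sym x23.
  by rewrite addnA.
rewrite cW !ltnS => W1.
have cD : #|D| = #|nbr e x1 :&: D| + (2 + #|W|) by rewrite -(cardsID (nbr e x1) D) setIC cW.
(* From each vertex of [K] starts a path in [K] through two neighbours of [x1], and the edge [v w]
   provides two more. Joining these disjoint sets inside [D] would give a path with four. *)
have indep v w : v \in nbr e x1 :&: D -> v \notin P -> w \in nbr e x1 :&: D -> w \notin P -> ~~ e v w.
  move=> /setIP[vN vD] vP /setIP[wN wD] wP; apply/negP=> evw.
  pose K := [set x2; x3] :|: P.
  have av x y : x \in D -> y \in D -> avoid e x1 x y = e x y.
    by move=> xD yD; rewrite /avoid (memPn x1D _ xD) (memPn x1D _ yD) !andbT.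
  have spK : spread (avoid e x1) (nbr e x1) 2 K.
    have inK p : p \in P -> p \in K by rewrite in_setU => ->; rewrite orbT.
    have inN p : p \in P -> p \in nbr e x1 by case/inP'; rewrite in_nbr.
    have ex2 z : exists p q, [/\ p \in P, q \in P, p != z, q != z & p != q].
      have [p pP] : exists2 p, p \in P & p \notin [:: z].
        by apply: ex_notin; apply: leq_trans P3.
      have [q qP] : exists2 q, q \in P & q \notin [:: z; p].
        by apply: ex_notin; apply: leq_trans P3.
      rewrite !inE negb_or => /andP[qz qp] pz.
      by exists p, q; split=> //; rewrite eq_sym.
    have hub z y : z \in D -> y \in D -> z \in K -> y \in K -> z != y ->
        (forall p, p \in P -> e z p /\ e y p) ->
        exists p, [/\ path (avoid e x1) z p, uniq (z :: p), {subset z :: p <= K}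
                   & 2 <= count [in nbr e x1] (z :: p)].
      move=> zD yD zK yK zy adj.
      have [p [q [pP qP _ _ pq]]] := ex2 z.
      have [[ezp eyp] [ezq eyq]] := (adj p pP, adj q qP).
      have [pD qD] := (PD p pP, PD q qP).
      exists [:: p; y; q]; split.
      - by rewrite /= !av // ezp (e_sym p) eyp eyq.
      - rewrite /= !inE !negb_or (adj_neq e_irr ezp) zy (adj_neq e_irr ezq).
        by rewrite (eq_sym p y) (adj_neq e_irr eyp) pq (adj_neq e_irr eyq).
      - by apply/allP; rewrite /= zK yK !inK.
      by rewrite /= (inN _ pP) (inN _ qP); move: (z \in _ : nat) (y \in _ : nat); clear; lia.
    have x2K : x2 \in K by rewrite !inE eqxx.
    have x3K : x3 \in K by rewrite !inE eqxx orbT.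
    move=> z /setUP[/set2P[]->|zP].
    - by apply: (hub x2 x3) => // p /inP'[].
    - by apply: (hub x3 x2) => // [|p /inP'[]//]; rewrite eq_sym.
    have [p [q [pP qP pz _ _]]] := ex2 z.
    have [e1z e2z e3z] := inP' zP; have [e1p e2p e3p] := inP' pP.
    have [zD pD] := (PD z zP, PD p pP).
    exists [:: x2; p]; split.
    - by rewrite /= !av // (e_sym z) e2z e2p.
    - by rewrite /= !inE negb_or (eq_sym z x2) (adj_neq e_irr e2z) (eq_sym z) pz (adj_neq e_irr e2p).
    - by apply/allP; rewrite /= x2K !inK.
    by rewrite /= (inN _ zP) (inN _ pP); move: (x2 \in _ : nat); clear; lia.
  have spvw : spread (avoid e x1) (nbr e x1) 2 [set v; w].
    move=> z /set2P[]->; [exists [:: w] | exists [:: v]]; split.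
    - by rewrite /= av // evw.
    - by rewrite /= inE (adj_neq e_irr evw).
    - by move=> t; rewrite !inE.
    - by rewrite /= vN wN.
    - by rewrite /= av // e_sym evw.
    - by rewrite /= inE eq_sym (adj_neq e_irr evw).
    - by move=> t; rewrite !inE orbC.
    - by rewrite /= vN wN.
  have notK t : t \in nbr e x1 -> t \notin P -> t \notin K.
    rewrite in_nbr => e1t tP; rewrite !inE !negb_or tP andbT.
    by apply/andP; split; apply: contraTneq e1t => ->.
  have dis : [disjoint K & [set v; w]].
    rewrite disjoint_sym; apply/pred0P=> t /=; apply/negbTE/negP.
    by case/andP=> /set2P[]->; apply/negP; apply: notK.
  have x2K : x2 \in K by rewrite !inE eqxx.
  have av_sym : symmetric (avoid e x1).
    by move=> y z; rewrite /avoid e_sym [X in _ && X]andbC.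
  have [s [ss Us]] := spread_path av_sym spK spvw dis x2K (set21 v w) (Dco _ _ x2D vD).
  by rewrite leqNgt ltnS (avoid_path_count e_sym free ss Us).
have nbr_le v : v \in nbr e x1 :&: D ->
    #|nbr e v :&: D| <= 2 + (v \in P) * #|nbr e v :&: W|.
  move=> /[dup] vND /setIP[vN vD]; have [vP|vP] := boolP (v \in P).
    have : nbr e v :&: D \subset [set x2; x3] :|: (nbr e v :&: W).
      apply/subsetP=> y /setIP[]; rewrite !inE => evy yD.
      case: (y =P x2) => //= _; case: (y =P x3) => //= _.
      rewrite evy yD andbT; apply: contraTN evy => e1y; rewrite e_sym.
      exact: noP e1y vP.
    move/subset_leq_card/leq_trans; apply; rewrite mul1n.
    by apply: leq_trans (leq_card_setU _ _) _; rewrite cards2 x23.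
  have : nbr e v :&: D \subset (nbr e v :&: [set x2; x3]) :|: W.
    apply/subsetP=> y /setIP[]; rewrite !inE => evy yD; rewrite evy /=.
    case: (y =P x2) => //= _; case: (y =P x3) => //= _.
    rewrite yD andbT; apply: contraTN evy => e1y.
    have [yP|yP] := boolP (y \in P); first by rewrite noP // -in_nbr.
    by apply: indep => //; rewrite inE in_nbr e1y.
  move/subset_leq_card/leq_trans; apply; rewrite mul0n addn0.
  apply: leq_trans (leq_card_setU _ _) _; rewrite -[2]/(1 + 1) leq_add //.
  (* A neighbour of [x1] adjacent to both [x2] and [x3] would lie in [P]. *)
  have : nbr e v :&: [set x2; x3] \proper [set x2; x3].
    rewrite properE subsetIr /=; apply: contra vP => /subsetP sub.
    have /setIP[+ _] := sub x2 (set21 _ _); have /setIP[+ _] := sub x3 (set22 _ _).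
    move: vN; rewrite !in_nbr inP e_sym => -> + +.
    by rewrite e_sym => ->; rewrite e_sym => ->.
  by move/proper_card; rewrite cards2 x23.
apply: (walks2_slack DP).
have incle : incidence e (nbr e x1) D <= \sum_(v in nbr e x1 :&: D) (2 + (v \in P) * #|nbr e v :&: W|).
  exact: leq_sum nbr_le.
(* The edges between [P] and [W] are counted from [W], whose vertices each see at most one vertex of
   [P]. *)
have sumW : \sum_(v in nbr e x1 :&: D) (v \in P) * #|nbr e v :&: W| <= #|W|.
  have -> : \sum_(v in nbr e x1 :&: D) (v \in P) * #|nbr e v :&: W| = \sum_(w in W) #|nbr e w :&: P|.
    have cardE (A B : {set 'I_n}) : #|A :&: B| = \sum_(x in B) (x \in A).
      rewrite -sum1_card big_mkcond [RHS]big_mkcond; apply: eq_bigr => x _.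
      by rewrite inE andbC; case: (x \in B).
    under [RHS]eq_bigr => w _ do rewrite cardE.
    rewrite exchange_big /=; rewrite big_mkcond [RHS]big_mkcond; apply: eq_bigr => v _.
    rewrite inE; case vP: (v \in P); last by rewrite mul0n; case: ifP.
    rewrite PD // in_nbr; case: (inP' vP) => -> _ _ /=; rewrite mul1n cardE.
    by apply: eq_bigr => w _; rewrite !in_nbr e_sym.
  rewrite -sum1_card; apply: leq_sum => w; rewrite !inE => /and4P[w3 w2 e1w wD].
  have w1 : w != x1 by rewrite (memPn x1D).
  apply/card_le1_eqP=> p q /setIP[+ pP] /setIP[+ qP]; rewrite !in_nbr => wp wq.
  by apply: (K3m_outside_nbr e_sym e_irr free x12 x13 x23 inP' P5 w1 w2 w3 qP pP wq wp).
rewrite big_split /= sum_nat_const in incle.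
rewrite cD; move: incle sumW; clear.
move: (incidence _ _ _) (\sum_(i in _) _) #|_ :&: _| #|W|; lia.
Qed.
End Fixed.

Lemma walks2_K36 : has_K36 e -> forall u, walks2 e u + 9 <= 3 * n.
Proof.
case=> x1 [x2 [x3 [x12 x13 x23 P6]]] u.
set P := _ :&: _ in P6.
have inP p : (p \in P) = [&& e x1 p, e x2 p & e x3 p] by rewrite !inE andbA.
have [->|u1] := eqVneq u x1; first exact: (@walks2_at_hub x1 x2 x3 P).
have [->|u2] := eqVneq u x2.
  apply: (@walks2_at_hub x2 x1 x3 P) => // [|p]; first by rewrite eq_sym.
  by rewrite inP andbCA.
have [->|u3] := eqVneq u x3.
  apply: (@walks2_at_hub x3 x1 x2 P) => // [||p]; rewrite 1?eq_sym //.
  by rewrite inP andbA andbC.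
exact: (@walks2_outside_hubs x1 x2 x3 P).
Qed.
End WalksK36.

(** * The trichotomy *)

Section Trichotomy.
Variables (n : nat) (e : rel 'I_n).
Hypotheses (e_sym : symmetric e) (e_irr : irreflexive e).

(* In the absence of a DCC1 the graph consists of copies of $K_4$ sharing [u] and at
   most one further vertex, pendant at a neighbour of [u]. *)
Definition windmill_center u :=
  [/\ forall x, x \in nbr e u -> #|nbr e x :&: nbr e u| = 2, n <= #|nbr e u| + 2,
      walks2 e u < n + 2 * #|nbr e u|, 2 * n + #|nbr e u| < walks2 e u + 4
    & 3 %| #|nbr e u|].

(** A vertex violating the first bound excludes K_{3,6}, so components with an independent triple
    become sparse too. At a vertex [u] violating the second bound no component can be sparse, since
    its slack of 2 would restore that bound. Hence each component contains a triangle of neighbours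
    of [u]. *)
Lemma walks2_trichotomy : ~ contains_DCC1 e ->
  [\/ forall u, walks2 e u + 9 <= 3 * n,
      forall u, walks2 e u + 4 <= 2 * n + #|nbr e u|
    | exists u, windmill_center u].
Proof.
move=> free; have [/forallP|] := boolP [forall u, walks2 e u + 9 <= 3 * n].
  by constructor 1.
rewrite negb_forall => /existsP[u0 bad0].
have noK : ~ has_K36 e by move/(walks2_K36 e_sym e_irr free)/(_ u0); apply/negP.
have [/forallP|] := boolP [forall u, walks2 e u + 4 <= 2 * n + #|nbr e u|].
  by constructor 2.
rewrite negb_forall => /existsP[u]; rewrite -ltnNge => bad1.
constructor 3; exists u.
have cases (D : {set 'I_n}) : D \in components e u ->
  incidence e (nbr e u) D + 2 <= 2 * #|D| \/
  [/\ #|nbr e u :&: D| = 3, incidence e (nbr e u) D <= #|D| + 3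
        & forall x, x \in nbr e u :&: D -> #|nbr e x :&: (nbr e u :&: D)| = 2].
  case/(component_cases e_sym e_irr free) => [||[_ _ K]]; [by left|by right|left].
  by rewrite leqNgt; apply/negP=> lt2; apply: noK; apply: K; move: lt2; rewrite addn2 addn1 ltnS.
have n0 := ltn_ord u.
have sumD := sum_card_components e_sym u.
have tri (D : {set 'I_n}) : D \in components e u ->
  [/\ #|nbr e u :&: D| = 3, incidence e (nbr e u) D <= #|D| + 3
        & forall x, x \in nbr e u :&: D -> #|nbr e x :&: (nbr e u :&: D)| = 2].
  move=> DP; case: (cases D DP) => // slackD; exfalso.
  have le_all D' : D' \in components e u -> #|nbr e u :&: D'| + incidence e (nbr e u) D'
      <= #|nbr e u :&: D'| + 2 * #|D'|.
    move=> /cases inc; rewrite leq_add2l.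
    case: inc => [|[a3 inc _]]; first by apply: leq_trans; rewrite leq_addr.
    apply: leq_trans inc _; rewrite mul2n -addnn leq_add2l -a3.
    by rewrite subset_leq_card ?subsetIr.
  have := leq_sum_slack (k := 2) le_all DP; rewrite -addnA leq_add2l => /(_ slackD).
  rewrite -walks2_components // big_split /= -degree_components // -big_distrr /= sumD.
  move: bad1 n0; clear; move: (walks2 e u) #|nbr e u|; lia.
have walks_le : walks2 e u < n + 2 * #|nbr e u|.
  rewrite walks2_components // degree_components //.
  have : \sum_(D in components e u) (#|nbr e u :&: D| + incidence e (nbr e u) D)
    <= \sum_(D in components e u) (2 * #|nbr e u :&: D| + #|D|).
    by apply: leq_sum => D /tri[-> inc _]; move: inc; clear; lia.
  rewrite big_split /= [X in _ <= X]big_split /= sumD -big_distrr /=.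
  move: n0; clear; lia.
split=> //.
- move=> x; rewrite in_nbr => ux.
  have xu : x != u by rewrite eq_sym (adj_neq e_irr).
  have [D DP xD] := component_of e_sym xu.
  have [_ _ Dcl _] := componentP e_sym DP; have [_ _ nb2] := tri D DP.
  rewrite -(nb2 x); last by rewrite inE in_nbr ux.
  apply: eq_card => y; rewrite !inE; case xy: (e x y) => //=; case uy: (e u y) => //=.
  by rewrite (Dcl x y xD _ xy) // eq_sym (adj_neq e_irr).
- by move: walks_le bad1; clear; lia.
by rewrite degree_components //; apply: dvdn_sum => D /tri[->].
Qed.

(** The set [W] off the closed neighbourhood of [u] has at most one vertex, and the walk bound at
    [u] allows at most [#|W|] edges to it. So neighbours of [u] have degree 3, with at most one of
    degree 4, and a vertex of [W] has degree at most 1. *)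
Lemma windmill_walks2 u : windmill_center u ->
  forall v, walks2 e v < n + 2 * #|nbr e v|.
Proof.
case=> two_nbrs n_le walks_u _ _ v.
have [-> //|vu] := eqVneq v u.
pose W := ~: (u |: nbr e u).
have uN : u \notin nbr e u by rewrite in_nbr e_irr.
have cW : n = 1 + #|nbr e u| + #|W|.
  by have := cardsC (u |: nbr e u); rewrite cardsU1 uN card_ord.
have W1 : #|W| <= 1 by move: cW n_le; clear; lia.
pose dW x := #|nbr e x :&: W|.
have splitS x (F : 'I_n -> nat) : \sum_(y in nbr e x) F y =
    (e x u) * F u + \sum_(y in nbr e x :&: nbr e u) F y + \sum_(y in nbr e x :&: W) F y.
  rewrite big_mkcond (bigD1 u) //= in_nbr -addnA; congr (_ + _).
    by case: (e x u); rewrite ?mul1n.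
  rewrite [X in _ = X + _]big_mkcond [X in _ = _ + X]big_mkcond -big_split /=.
  rewrite big_mkcond; apply: eq_bigr => y _; rewrite !inE.
  case: eqVneq => [->|yu]; first by rewrite e_irr !andbF.
  by case: (e x y); case: (e u y); rewrite /= ?addn0.
have degE x : x \in nbr e u -> #|nbr e x| = 3 + dW x.
  move=> xN; rewrite -sum1_card splitS !sum1_card two_nbrs //.
  by move: xN; rewrite in_nbr e_sym => ->.
have sum_dW : \sum_(x in nbr e u) dW x <= #|W|.
  move: walks_u; rewrite /walks2 (eq_bigr _ degE) big_split /= sum_nat_const => h; move: h cW.
  by move: #|nbr e u| #|W| (\sum_(x in _) dW x); clear; lia.
have degW w : w \in W -> #|nbr e w| <= 1.
  move=> wW; apply: leq_trans (W1); apply: leq_trans (sum_dW).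
  have -> : #|nbr e w| = \sum_(x in nbr e u) e x w.
    rewrite -sum1_card splitS.
    have -> : e w u = false.
      by apply: contraTF wW; rewrite e_sym => uw; rewrite !inE negbK uw orbT.
    rewrite [X in _ + X]big1 ?addn0 => [|y /setIP[+ yW]]; last first.
      by rewrite in_nbr (card_le1_eqP W1 _ _ wW yW) e_irr.
    rewrite big_mkcond [RHS]big_mkcond; apply: eq_bigr => x _; rewrite !inE (e_sym w).
    by case: (e u x); case: (e x w).
  apply: leq_sum => x xN; case xw: (e x w) => //.
  by rewrite card_gt0; apply/set0Pn; exists w; rewrite inE in_nbr xw.
have dW1 x : dW x <= 1 by apply: leq_trans (W1); rewrite subset_leq_card ?subsetIr.
have [vN|vN] := boolP (v \in nbr e u).
  rewrite /walks2 splitS (degE v vN).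
  have -> : e v u by rewrite e_sym -in_nbr.
  have -> : \sum_(y in nbr e v :&: nbr e u) #|nbr e y| = 6 + \sum_(y in nbr e v :&: nbr e u) dW y.
    rewrite (eq_bigr (fun y => 3 + dW y)) => [|y /setIP[_ /degE//]].
    by rewrite big_split /= sum_nat_const two_nbrs.
  have : \sum_(y in nbr e v :&: nbr e u) dW y <= #|W|.
    apply: leq_trans (sum_dW); rewrite [X in _ <= X](bigID [in nbr e v]) /=.
    rewrite -[X in X <= _]addn0 leq_add //.
    by rewrite (eq_bigl (fun i => (i \in nbr e u) && (i \in nbr e v))) // => i; rewrite inE andbC.
  have : \sum_(y in nbr e v :&: W) #|nbr e y| <= dW v.
    by rewrite /dW -sum1_card; apply: leq_sum => y /setIP[_ /degW].
  move: cW; rewrite mul1n; clear.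
  move: (\sum_(y in _ :&: nbr _ _) _) (\sum_(y in _ :&: W) _) #|nbr e u| #|W| (dW v); clear; lia.
have vW : v \in W by rewrite in_setC in_setU1 negb_or vu.
have [n_v|[x]] := set_0Vmem (nbr e v).
  by rewrite /walks2 n_v big_set0 cards0 addn0; apply: leq_trans (ltn_ord v).
rewrite in_nbr => vx.
have nbrvN y : e v y -> y \in nbr e u.
  move=> vy; apply: contraT => yN; exfalso.
  have yW : y \in W.
    rewrite in_setC in_setU1 negb_or yN andbT; apply: contraNneq vN => <-.
    by rewrite in_nbr e_sym.
  by move: vy; rewrite (card_le1_eqP W1 _ _ vW yW) e_irr.
have : walks2 e v <= 4 * #|nbr e v|.
  rewrite /walks2 mulnC -sum_nat_const; apply: leq_sum => y; rewrite in_nbr => /nbrvN/degE->.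
  by rewrite -addn1 -addnA leq_add2l ltnS.
have : 3 <= #|nbr e x| by rewrite degE ?nbrvN // leq_addr.
have : #|nbr e x| <= n by rewrite -[X in _ <= X]card_ord max_card.
have := degW v vW; move: (walks2 e v) #|nbr e v| #|nbr e x|; clear; lia.
Qed.

End Trichotomy.

(** * Equality cases *)

Lemma perm_onto_initial n (A : {set 'I_n}) :
  exists f : {perm 'I_n}, forall x, (f x < #|A|) = (x \in A).
Proof.
pose s := enum A ++ enum (~: A).
have sn : size s = n by rewrite size_cat -!cardE cardsC card_ord.
have s_all x : x \in s by rewrite mem_cat !mem_enum in_setC orbN.
have idx x : index x s < n by rewrite -[X in _ < X]sn index_mem.
pose g x := Ordinal (idx x).
have g_inj : injective g.
  by move=> x y [/(congr1 (nth x s))]; rewrite !nth_index.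
exists (perm g_inj) => x; rewrite permE /= index_cat mem_enum cardE.
case xA: (x \in A); first by rewrite index_mem mem_enum xA.
by apply/negbTE; rewrite -leqNgt leq_addr.
Qed.

Section EqualityCase.
Variables (n : nat) (e : rel 'I_n).
Hypotheses (e_sym : symmetric e) (e_irr : irreflexive e).
Hypothesis free : ~ contains_DCC1 e.

Lemma degree_lt v : #|nbr e v| <= n.-1.
Proof.
rewrite -[X in _ <= X.-1]card_ord -(cardC1 v) subset_leq_card //.
by apply/subsetP=> x; rewrite in_nbr => /(adj_neq e_irr); rewrite !inE eq_sym.
Qed.

Lemma full_degree_adj v y : #|nbr e v| = n.-1 -> y != v -> e v y.
Proof.
move=> dv yv; have sub : nbr e v \subset predC1 v.
  by apply/subsetP=> z; rewrite in_nbr !inE eq_sym; apply: adj_neq.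
have : y \in predC1 v by [].
rewrite -in_nbr; apply: subsetP.
by rewrite -(geq_leqif (subset_leqif_card sub)) cardC1 card_ord dv.
Qed.

(** A path in [S] is extended at its head until every neighbour of the head lies on it;
    [path_nbr_count] then bounds the degree. *)
Lemma low_degree_vertex (S : {set 'I_n}) : S != set0 ->
  (forall u v, u \in S -> e u v -> v \in S) -> exists2 v, v \in S & #|nbr e v| <= 3.
Proof.
case/set0Pn=> v vS Scl.
suff ext m s v0 : n - size s < m -> v0 \in S -> uniq (v0 :: s) -> path e v0 s ->
    exists2 v, v \in S & #|nbr e v| <= 3.
  by apply: (ext n.+1 [::] v); rewrite ?subn0.
elim: m s v0 => // m IHm s v0 lt_m v0S Us ps.
have [sub|/subsetPn[x]] := boolP (nbr e v0 \subset s).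
  exists v0 => //; move: Us => /= /andP[v0s Us].
  apply: leq_trans (path_nbr_count e_sym free (path_sorted ps) Us v0s).
  rewrite -size_filter cardE; apply: uniq_leq_size (enum_uniq _) _ => x.
  by rewrite mem_enum mem_filter => xN; rewrite (subsetP sub) // andbT -in_nbr.
rewrite in_nbr => v0x xs.
apply: (IHm (v0 :: s) x); last by rewrite /= e_sym v0x.
- have : size (v0 :: s) <= n by rewrite -(card_uniqP Us) -[X in _ <= X]card_ord max_card.
  by move: lt_m => /=; lia.
- exact: Scl v0S v0x.
by rewrite cons_uniq Us inE negb_or xs andbT eq_sym (adj_neq e_irr).
Qed.

Lemma walks2_le_degree v : walks2 e v <= #|nbr e v| * n.-1.
Proof. by rewrite -sum_nat_const; apply: leq_sum => x _; apply: degree_lt. Qed.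

(** * Vertices of degree three *)

Section DegreeThree.
Variables (v a b c : 'I_n).
Hypotheses (ab : a != b) (ac : a != c) (bc : b != c).
Hypothesis nbr_v : nbr e v = [set a; b; c].
Let B := ~: (v |: [set a; b; c]).

Lemma deg3_adj : [/\ e v a, e v b & e v c].
Proof. by rewrite -!in_nbr nbr_v !inE !eqxx !orbT. Qed.

Lemma deg3_notin : [/\ v \notin B, a \notin B, b \notin B & c \notin B].
Proof. by rewrite !inE !eqxx !orbT. Qed.

Lemma deg3_cardB : #|B| + 4 = n.
Proof.
have c4 : #|v |: [set a; b; c]| = 4.
  rewrite cardsU1 -nbr_v in_nbr e_irr nbr_v -setUA cardsU1 cards2 !inE negb_or ab ac bc.
  by [].
by have := cardsC (v |: [set a; b; c]); rewrite c4 card_ord addnC.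
Qed.

Lemma deg3_degree x : x \in [set a; b; c] ->
  #|nbr e x| = 1 + (e x a + e x b + e x c) + #|nbr e x :&: B|.
Proof.
move=> xN; rewrite -(cardsID B) setDE setCK addnC; congr (_ + _).
have xv : e x v by rewrite e_sym -in_nbr nbr_v.
rewrite (cardsD1 v) in_setI in_nbr xv in_setU1 eqxx /=.
rewrite -card_nbr3 //; congr (_ + _); apply: eq_card => y; rewrite !inE.
case: eqVneq => [->|_] /=; last by rewrite andbC.
by have [va vb vc] := deg3_adj; rewrite !(negPf (adj_neq e_irr _)) // andbF.
Qed.

Lemma deg3_walks2 : walks2 e v = links e a b c B + 2 * (e a b + e a c + e b c) + 3.
Proof.
rewrite /walks2 nbr_v big_set3 // !deg3_degree ?inE ?eqxx ?orbT // /links.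
rewrite !e_irr (e_sym b a) (e_sym c a) (e_sym c b).
move: (e a b : nat) (e a c : nat) (e b c : nat) #|_ :&: _| #|_ :&: _| #|_ :&: _|.
by clear; lia.
Qed.

Lemma linksD1 (C : {set 'I_n}) w : w \in C ->
  links e a b c C = links e a b c (C :\ w) + (e a w + e b w + e c w).
Proof.
move=> wC; have one x : #|nbr e x :&: C| = #|nbr e x :&: (C :\ w)| + e x w.
  by rewrite (cardsD1 w) in_setI in_nbr wC andbT setIDA addnC.
rewrite /links !one; move: (e a w : nat) (e b w : nat) (e c w : nat).
by move: #|_ :&: (C :\ w)| #|_ :&: (C :\ w)| #|_ :&: (C :\ w)|; clear; lia.
Qed.

Lemma deg3_links_bound (C : {set 'I_n}) : C \subset B ->
  links e a b c C <= match (e a b + e a c + e b c)%N with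
    | 0 => 3 * #|C| | 1 => 2 * #|C| + 1 | 2 => 2 * #|C| | _ => #|C| end.
Proof.
move=> CB; have [va vb vc] := deg3_adj; have [vB aB bB cB] := deg3_notin.
by apply: (links_bound e_sym e_irr free va vb vc) => //; apply: contra (subsetP CB _) _.
Qed.

(* If no two of the neighbours of [v] are adjacent and enough edges join them to
   the rest of the graph, the rest together with [v] is an independent set. *)
Lemma deg3_independent : 4 <= #|B| -> e a b + e a c + e b c = 0 ->
  3 * #|B| <= links e a b c B + 1 ->
  forall x y, x \notin [set a; b; c] -> y \notin [set a; b; c] -> ~~ e x y.
Proof.
move=> B4 T0 lk.
have kB w : w \in B -> 2 <= e a w + e b w + e c w.
  move=> wB; have := linksD1 wB; have := deg3_links_bound (subsetDl B [set w]).
  have := cardsD1 w B; rewrite wB T0; move: lk; clear.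
  move: (links e _ _ _ _) (links e _ _ _ _) (_ + _ + _)%N #|_ :\ _| #|B|; lia.
have [va vb vc] := deg3_adj.
have outB x : x \notin [set a; b; c] -> x != v -> x \in B.
  by move=> xN xv; rewrite in_setC in_setU1 negb_or xv.
pose P := nbr e a :&: nbr e b :&: nbr e c.
have inP p : p \in P -> [/\ e a p, e b p & e c p].
  by rewrite !inE => /andP[/andP[]].
have vP : v \in P by rewrite !inE !(e_sym _ v) va vb vc.
(* At most one edge to the triple is missing, so at most one vertex off the triple fails to see all
   of it. *)
have PN x y : x \notin [set a; b; c] -> y \notin [set a; b; c] -> x != y ->
    x \notin P -> y \in P.
  move=> xN yN xy xP; have [->//|yv] := eqVneq y v.
  have xv : x != v by apply: contraNneq xP => ->.
  apply: contraT => yP.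
  have [xB yB] := (outB x xN xv, outB y yN yv).
  have yB' : y \in B :\ x by rewrite in_setD1 eq_sym xy.
  have k2 z : z \notin P -> e a z + e b z + e c z <= 2.
    by rewrite !inE; case: (e a z); case: (e b z); case: (e c z).
  have := linksD1 xB; have := linksD1 yB'; have := k2 x xP; have := k2 y yP.
  have sub : B :\ x :\ y \subset B by rewrite (subset_trans (subsetDl _ _)) ?subsetDl.
  have := deg3_links_bound sub.
  have := cardsD1 x B; have := cardsD1 y (B :\ x); rewrite xB yB' T0.
  move: lk; clear.
  move: (links e a b c (B :\ x :\ y)) (links e a b c (B :\ x)) (links e a b c B).
  move: (e a x + e b x + e c x) (e a y + e b y + e c y) #|B :\ x :\ y| #|B :\ x| #|B|.
  by clear; lia.
have P4 : 3 < #|P|.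
  have [/subset_leq_card|/subsetPn[w wB wP]] := boolP (B \subset P).
    by apply: leq_trans.
  have : v |: (B :\ w) \subset P.
    apply/subsetP=> y; rewrite in_setU1 in_setD1 => /predU1P[->//|/andP[yw yB]].
    apply: (PN w y); rewrite 1?eq_sym //; move: wB yB; rewrite !in_setC !in_setU1 !negb_or.
      by case/andP=> _.
    by move=> _ /andP[_].
  move/subset_leq_card; rewrite cardsU1; have := cardsD1 w B; rewrite wB.
  have -> : v \notin B :\ w by have [vB _ _ _] := deg3_notin; rewrite in_setD1 (negPf vB) andbF.
  by move: B4; clear; move: #|_ :\ _| #|B| #|P|; lia.
(* Some vertex of the triple is adjacent to [x] and takes the role of the first hub. *)
have leaf x y : x \notin [set a; b; c] -> y \in P -> ~~ e x y.
  move=> xN yP; have /and3P[xa xb xc] : [&& x != a, x != b & x != c].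
    by move: xN; rewrite !inE -orbA !negb_or.
  have k1 : 0 < e a x + e b x + e c x.
    have [->|xv] := eqVneq x v; first by rewrite !(e_sym _ v) va vb vc.
    by apply: leq_trans (kB x (outB x xN xv)).
  have [ba ca cb] : [/\ b != a, c != a & c != b] by rewrite eq_sym ab eq_sym ac eq_sym bc.
  have [ax|ax] := boolP (e a x).
    exact: (K3m_leaf_nonadj e_sym e_irr free ab ac bc inP).
  have [bx|bx] := boolP (e b x).
    by apply: (K3m_leaf_nonadj e_sym e_irr free ba bc ac _ P4 bx xa xc yP) => p /inP[].
  have cx : e c x by move: k1; rewrite (negPf ax) (negPf bx); case: (e c x).
  by apply: (K3m_leaf_nonadj e_sym e_irr free ca cb ab _ P4 cx xa xb yP) => p /inP[].
move=> x y xN yN; have [->|xy] := eqVneq x y; first by rewrite e_irr.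
have [xP|xP] := boolP (x \in P); first by rewrite e_sym leaf.
by apply: leaf => //; apply: PN xy xP.
Qed.

End DegreeThree.

Lemma no_edge_in3 a b c : e a b + e a c + e b c = 0 ->
  forall x y, x \in [set a; b; c] -> y \in [set a; b; c] -> e x y = false.
Proof.
move=> T0 x y; case eab: (e a b) T0; case eac: (e a c); case ebc: (e b c) => // _.
rewrite !inE -!orbA => /or3P[]/eqP-> /or3P[]/eqP->.
all: by rewrite ?e_irr // e_sym.
Qed.

Variable S : {set 'I_n}.
Hypotheses (S0 : S != set0) (S_closed : forall u v, u \in S -> e u v -> v \in S).

(** A vertex of degree at most 3 in [S] must have degree 3. With T edges among its neighbours,
    equality there says that the links number [3 * #|B| - 2 T]. As [#|B| >= 6], the bounds on links
    leave only T = 0, with all links present. *)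
Lemma K3_equality : 10 <= n -> (forall u, u \in S -> walks2 e u = 3 * n - 9) ->
  graph_iso e (@K3_rel n).
Proof.
move=> n10 eqS; have [v vS dv] := low_degree_vertex S0 S_closed.
have dv3 : #|nbr e v| = 3.
  apply/eqP; rewrite eqn_leq dv ltnNge; apply/negP=> dv2.
  have := walks2_le_degree v; rewrite eqS // leqNgt => /negP; apply.
  apply: (@leq_ltn_trans (2 * n.-1)); first by rewrite leq_mul2r dv2 orbT.
  by move: n10; clear; lia.
have [a [b [c [ab ac bc nE]]]] := cards3_ex dv3.
have cB := deg3_cardB ab ac bc nE; have wE := deg3_walks2 ab ac bc nE.
have bound := deg3_links_bound ab ac bc nE.
rewrite (eqS v vS) in wE; set B := ~: _ in cB wE bound.
have B6 : 6 <= #|B| by move: cB n10; clear; move: #|B|; lia.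
have [T0 lk] : e a b + e a c + e b c = 0 /\ links e a b c B = 3 * #|B|.
  have T3 : e a b + e a c + e b c <= 3 by case: (e a b); case: (e a c); case: (e b c).
  have := bound B (subxx _); move: T3 wE cB B6; clear.
  move: (e a b + e a c + e b c) (links _ _ _ _ _) #|B| => [|[|[|T]]] l m /=; lia.
have indep : forall x y, x \notin [set a; b; c] -> y \notin [set a; b; c] -> ~~ e x y.
  apply: (deg3_independent ab ac bc nE) => //; rewrite -/B.
    by apply: leq_trans B6.
  by rewrite lk leq_addr.
have full x y : x \in [set a; b; c] -> y \notin [set a; b; c] -> e x y.
  move=> xA yA; have [->|yv] := eqVneq y v; first by rewrite e_sym -in_nbr nE.
  have yB : y \in B by rewrite in_setC in_setU1 negb_or yv.
  have k3 : 3 <= e a y + e b y + e c y.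
    have := bound _ (subsetDl B [set y]); have := linksD1 a b c yB.
    have := cardsD1 y B; rewrite yB T0 lk; clear.
    by move: (links e _ _ _ _) #|_ :\ _| #|B| (_ + _ + _); lia.
  by move: xA; rewrite !inE -orbA => /or3P[]/eqP->; move: k3;
    case: (e a y); case: (e b y); case: (e c y).
have [f fP] := perm_onto_initial [set a; b; c].
exists f => x y; rewrite /K3_rel -[3](_ : #|[set a; b; c]| = 3) ?fP; last by rewrite -nE.
case xA: (x \in [set a; b; c]); case yA: (y \in [set a; b; c]) => /=.
- exact: no_edge_in3 T0 _ _ xA yA.
- by apply: full; rewrite ?yA.
- by rewrite e_sym; apply: full; rewrite ?xA.
by apply/negbTE/indep; rewrite ?xA ?yA.
Qed.

(** An edge [x y] off [a] and [b] would give the path [x, y, b, q] of neighbours of [a]. *)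
Lemma two_full_vertices a b : 6 <= n -> a != b ->
  (forall x, x != a -> e a x) -> (forall x, x != b -> e b x) ->
  graph_iso e (@K11_rel n).
Proof.
move=> n6 ab fa fb; have c2 : #|[set a; b]| = 2 by rewrite cards2 ab.
have [f fP] := perm_onto_initial [set a; b].
exists f => x y; rewrite /K11_rel (inj_eq perm_inj) ![2 <= _]leqNgt -[2]c2 !fP.
have [->|xy] := eqVneq x y; first by rewrite e_irr.
have [xA|xA] := boolP (x \in [set a; b]) => /=.
  by case/set2P: xA xy => -> xy; rewrite ?fa ?fb // eq_sym.
have [yA|yA] /= := boolP (y \in [set a; b]).
  by rewrite e_sym; case/set2P: yA xy => -> xy; rewrite ?fa ?fb.
apply/negP=> exy.
have [q _ qN] : exists2 q, q \in [set: 'I_n] & q \notin [:: a; b; x; y].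
  by apply: ex_notin; rewrite cardsT card_ord; apply: leq_trans n6.
move: xA yA qN; rewrite !inE !negb_or => /andP[xa xb] /andP[ya yb] /and4P[qa qb qx qy].
apply: (@no_fan n e e_sym free a [:: x; y; b; q]).
- by rewrite /= exy e_sym !fb.
- rewrite /= !inE !negb_or xy xb (eq_sym x q) qx yb (eq_sym y q) qy.
  by rewrite (eq_sym b q) qb.
- by rewrite !inE !negb_or ab !(eq_sym a) xa ya qa.
by rewrite /= !fa // eq_sym.
Qed.

(** Equality at [v] gives every vertex of [B] two neighbours in the triple, and a fan at [b]
    excludes [b]. A vertex [w] of [B] then has neighbourhood [[set a; c]]. Equality at [w] needs [a]
    and [c] to have degree sum [2 * n - 2], but they are not adjacent. *)
Lemma two_path_of_degree3 v a b c : 6 <= n ->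
  (forall u, u \in S -> walks2 e u + 4 = 2 * n + #|nbr e u|) -> v \in S ->
  a != b -> a != c -> b != c -> nbr e v = [set a; b; c] ->
  e a b -> e b c -> ~~ e a c -> False.
Proof.
move=> n6 eqS vS ab ac bc nE eab ebc eac.
have cB := deg3_cardB ab ac bc nE; have wE := deg3_walks2 ab ac bc nE.
have bound := deg3_links_bound ab ac bc nE.
have [va vb vc] := deg3_adj nE; have [vB aB bB cB'] := deg3_notin v a b c.
set B := ~: _ in cB wE bound vB aB bB cB'.
have T2 : e a b + e a c + e b c = 2 by rewrite eab ebc (negPf eac).
rewrite T2 in wE bound.
have lk : links e a b c B = 2 * #|B|.
  have := eqS v vS; rewrite wE nE -(_ : 3 = #|[set a; b; c]|); last first.
    by rewrite -setUA cardsU1 cards2 !inE negb_or ab ac bc.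
  by move: cB; clear; move: (links _ _ _ _ _) #|B|; lia.
have adjB w : w \in B -> [/\ e a w, e c w & ~~ e b w].
  move=> wB; have k2 : e a w + e b w + e c w = 2.
    have wB1 : [set w] \subset B by rewrite sub1set.
    have := bound _ (subsetDl B [set w]); have := linksD1 a b c wB.
    have := bound _ wB1; have := linksD1 a b c (set11 w).
    have -> : links e a b c ([set w] :\ w) = 0 by rewrite setDv /links !setI0 cards0.
    have := cardsD1 w B; rewrite wB lk cards1; clear.
    by move: (links e a b c [set w]) (links e a b c (B :\ w)) #|_ :\ _| #|B| (_ + _ + _); lia.
  have wv : v != w by apply: contraNneq vB => ->.
  have [aw bw cw] : [/\ a != w, b != w & c != w].
    by split; [apply: contraNneq aB => -> | apply: contraNneq bB => -> | apply: contraNneq cB' => ->].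
  have ba : b != a by rewrite eq_sym.
  have bv : b != v by rewrite eq_sym (adj_neq e_irr).
  have cv : c != v by rewrite eq_sym (adj_neq e_irr).
  move: k2; case eaw: (e a w); case ebw: (e b w); case ecw: (e c w) => // _; exfalso.
    apply: (@no_fan n e e_sym free b [:: w; a; v; c]).
    - by rewrite /= e_sym eaw e_sym va vc.
    - rewrite /= !inE !negb_or !(eq_sym w) aw wv cw ac (eq_sym a v) (adj_neq e_irr va).
      by rewrite (adj_neq e_irr vc).
    - by rewrite !inE !negb_or bw ba bv bc.
    by rewrite /= ebw (e_sym b a) eab (e_sym b v) vb ebc.
  apply: (@no_fan n e e_sym free b [:: w; c; v; a]).
  - by rewrite /= e_sym ecw e_sym vc va.
  - rewrite /= !inE !negb_or !(eq_sym w) aw wv cw (eq_sym c a) ac cv.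
    by rewrite (adj_neq e_irr va).
  - by rewrite !inE !negb_or bw ba bv bc.
  by rewrite /= ebw (e_sym b a) eab (e_sym b v) vb ebc.
have [w wB] : exists w, w \in B.
  by apply/set0Pn; rewrite -card_gt0; move: cB n6; clear; move: #|B|; lia.
have [eaw ecw ebw] := adjB w wB.
have nbr_w : nbr e w = [set a; c].
  apply/setP=> y; rewrite in_nbr in_set2; apply/idP/idP; last first.
    by case/orP=> /eqP->; rewrite e_sym.
  move=> ewy; apply: contraT; rewrite negb_or => /andP[ya yc]; exfalso.
  have yv : y != v.
    apply: contraTneq wB => yv; rewrite in_setC in_setU1 -nE in_nbr.
    by rewrite -yv (e_sym y) ewy orbT.
  have yb : y != b by apply: contraNneq ebw => <-; rewrite e_sym.
  have yB : y \in B by rewrite in_setC in_setU1 negb_or yv !inE !negb_or ya yb.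
  have [eay ecy _] := adjB y yB.
  have wv : w != v by apply: contraNneq vB => <-.
  have wb : w != b by apply: contraNneq bB => <-.
  apply: (@no_fan n e e_sym free a [:: v; b; c; w; y]).
  - by rewrite /= vb ebc ecw ewy.
  - rewrite /= !inE !negb_or (adj_neq e_irr vb) (adj_neq e_irr vc) !(eq_sym v) wv yv bc.
    by rewrite !(eq_sym b) wb yb (adj_neq e_irr ecw) (adj_neq e_irr ecy) (adj_neq e_irr ewy).
  - rewrite !inE !negb_or (eq_sym a v) (adj_neq e_irr va) ab ac.
    by rewrite (adj_neq e_irr eaw) (adj_neq e_irr eay).
  by rewrite /= (e_sym a v) va eab eaw eay (negPf eac).
have wS : w \in S.
  by apply: S_closed eaw; apply: S_closed vS va.
have deg_le x y : x != y -> ~~ e x y -> #|nbr e x| + 2 <= n.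
  move=> xy nxy; rewrite -[X in _ <= X]card_ord -(cardC (nbr e x)) leq_add2l.
  have <- : #|[set x; y]| = 2 by rewrite cards2 xy.
  by apply/subset_leq_card/subsetP=> z /set2P[]->; rewrite inE /= in_nbr ?e_irr.
have := eqS w wS; rewrite /walks2 nbr_w cards2 ac big_setU1 ?inE //= big_set1.
have := deg_le a c ac eac; have := deg_le c a; rewrite eq_sym ac e_sym eac => /(_ isT isT).
by move: n6; clear; move: #|nbr e a| #|nbr e c|; lia.
Qed.

(** Equality at [v] forces two vertices in [B] and two links, so [n = 6]. A linked vertex [w] of [B]
    has at most one neighbour in the triple, of degree at most 5, and one in [B], of degree at most
    2. This is too little for equality at [w]. *)
Lemma no_triangle_of_degree3 v a b c : 6 <= n ->
  (forall u, u \in S -> walks2 e u + 4 = 2 * n + #|nbr e u|) -> v \in S ->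
  a != b -> a != c -> b != c -> nbr e v = [set a; b; c] ->
  e a b + e a c + e b c = 3 -> False.
Proof.
move=> n6 eqS vS ab ac bc nE T3.
have cB := deg3_cardB ab ac bc nE; have wE := deg3_walks2 ab ac bc nE.
have bound := deg3_links_bound ab ac bc nE.
have [va vb vc] := deg3_adj nE; have [vB aB bB cB'] := deg3_notin v a b c.
set B := ~: _ in cB wE bound vB aB bB cB'.
rewrite T3 in wE bound.
have c3 : #|[set a; b; c]| = 3 by rewrite -setUA cardsU1 cards2 !inE negb_or ab ac bc.
have [lk B2] : links e a b c B = 2 /\ #|B| = 2.
  have := bound B (subxx _); have := eqS v vS; rewrite wE nE c3.
  by move: cB n6; clear; move: (links _ _ _ _ _) #|B|; lia.
have nbrA y : y \in B -> #|nbr e y :&: [set a; b; c]| <= 1.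
  move=> yB; rewrite card_nbr3 // !(e_sym y).
  have := bound [set y]; rewrite sub1set yB => /(_ isT).
  rewrite (linksD1 a b c (set11 y)) cards1; apply: leq_trans; exact: leq_addl.
have nbrB y : y \in B -> #|nbr e y :&: B| <= 1.
  move=> yB; have <- : #|B :\ y| = 1 by move: (cardsD1 y B); rewrite yB B2 => -[].
  apply/subset_leq_card/subsetP=> z /setIP[]; rewrite in_nbr => yz zB.
  by rewrite in_setD1 zB eq_sym (adj_neq e_irr).
have nbrE y : y \in B -> nbr e y = nbr e y :&: [set a; b; c] :|: nbr e y :&: B.
  move=> yB; apply/setP=> z; rewrite -setIUr !in_setI in_nbr; case yz: (e y z) => //=.
  symmetry; rewrite in_setU in_setC in_setU1; case: eqVneq => [zv|_]; last by rewrite orbN.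
  exfalso; move: yB; rewrite in_setC in_setU1 -nE in_nbr e_sym -zv yz orbT.
  by [].
have degB y : y \in B -> #|nbr e y| <= 2.
  move=> yB; rewrite (nbrE y yB); apply: leq_trans (leq_card_setU _ _) _.
  exact: (leq_add (nbrA y yB) (nbrB y yB)).
have [w wB ewN] : exists2 w, w \in B & exists2 x, x \in [set a; b; c] & e x w.
  have [/existsP[x /andP[xN /existsP[w /andP[wB xw]]]]|none] :=
    boolP [exists x, (x \in [set a; b; c]) && [exists w, (w \in B) && e x w]].
    by exists w => //; exists x.
  have n0 x : x \in [set a; b; c] -> #|nbr e x :&: B| = 0.
    move=> xN; apply/eqP; rewrite cards_eq0; apply: contraNT none => /set0Pn[w /setIP[]].
    by rewrite in_nbr => xw wB; apply/existsP; exists x; rewrite xN; apply/existsP; exists w; rewrite wB.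
  by move: lk; rewrite /links !n0 ?inE ?eqxx ?orbT.
have wS : w \in S.
  case: ewN => x xN; apply: S_closed; rewrite -nE in_nbr in xN; exact: S_closed vS xN.
have := eqS w wS; have : walks2 e w <= 7; last first.
  by move: n6; clear; move: (walks2 e w) #|nbr e w|; lia.
rewrite /walks2 (nbrE w wB) (bigID [in B]) /= addnC.
have n5 : n.-1 = 5 by rewrite -cB B2.
apply: (@leq_add _ _ 5 2).
  apply: (@leq_trans (#|nbr e w :&: [set a; b; c]| * 5)); last first.
    by rewrite -[X in _ <= X]mul1n leq_mul2r nbrA.
  rewrite -sum_nat_const -n5.
  rewrite [X in X <= _](eq_bigl [in nbr e w :&: [set a; b; c]]).
    by apply: leq_sum => y _; apply: degree_lt.
  move=> y; rewrite in_setU !in_setI; case: (y \in nbr e w) => //=.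
  case yN: (y \in [set a; b; c]) => /=; last by case: (y \in B).
  by apply/negP=> yB; move: yB; rewrite in_setC in_setU1 yN orbT.
apply: (@leq_trans (#|nbr e w :&: B| * 2)); last first.
  by rewrite -[X in _ <= X]mul1n leq_mul2r nbrB.
rewrite -sum_nat_const [X in X <= _](eq_bigl [in nbr e w :&: B]).
  by apply: leq_sum => y /setIP[_]; apply: degB.
move=> y; rewrite in_setU !in_setI; case: (y \in nbr e w) => //=.
by case: (y \in B); rewrite ?orbT ?andbT ?andbF.
Qed.

Lemma K11_equality : 6 <= n <= 9 ->
  (forall u, u \in S -> walks2 e u + 4 = 2 * n + #|nbr e u|) -> graph_iso e (@K11_rel n).
Proof.
case/andP=> n6 n9 eqS; have [v vS dv] := low_degree_vertex S0 S_closed.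
have [dv3|dv3] := eqVneq #|nbr e v| 3; last first.
  have dv2 : #|nbr e v| = 2.
    have := walks2_le_degree v; have := eqS v vS; move: dv dv3 n6; clear.
    by move: (walks2 e v) #|nbr e v| => w [|[|[|[|d]]]]; lia.
  have /cards2P[a [b [ab nE]]] : #|nbr e v| == 2 by rewrite dv2.
  have := eqS v vS; rewrite dv2 /walks2 nE big_setU1 ?inE //= big_set1.
  have := degree_lt a; have := degree_lt b => db da sum_ab.
  apply: (two_full_vertices n6 ab) => y; apply: full_degree_adj; move: sum_ab da db n6; clear.
    by move: #|nbr e a| #|nbr e b|; lia.
  by move: #|nbr e a| #|nbr e b|; lia.
have [a [b [c [ab ac bc nE]]]] := cards3_ex dv3.
have [ba ca cb] : [/\ b != a, c != a & c != b] by rewrite eq_sym ab eq_sym ac eq_sym bc.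
have cB := deg3_cardB ab ac bc nE; have wE := deg3_walks2 ab ac bc nE.
have := deg3_links_bound ab ac bc nE (subxx _).
set B := ~: _ in cB wE *.
have perm_abc : nbr e v = [set b; a; c] /\ nbr e v = [set a; c; b].
  rewrite nE; split; apply/setP=> x; rewrite !inE -!orbA.
    by case: (x == a); case: (x == b); case: (x == c).
  by case: (x == a); case: (x == b); case: (x == c).
case: perm_abc => nE1 nE2.
have eqv := eqS v vS; rewrite wE dv3 in eqv.
case T: (e a b + e a c + e b c) => [|[|[|[|k]]]] bound; exfalso.
(* The links number [2 * #|B| + 4]. Because [n <= 9] gives [#|B| <= 5], at most one is missing from
   [3 * #|B|], and [deg3_independent] applies. *)
- have lk : links e a b c B + 4 = 2 * n.
    by move: eqv; rewrite T; clear; move: (links _ _ _ _ _); lia.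
  have indep : forall x y, x \notin [set a; b; c] -> y \notin [set a; b; c] -> ~~ e x y.
    apply: (deg3_independent ab ac bc nE) => //; rewrite -/B; move: lk bound cB n9; clear.
      by move: (links _ _ _ _ _) #|B|; lia.
    by move: (links _ _ _ _ _) #|B|; lia.
  have [va _ _] := deg3_adj nE.
  have aA : a \in [set a; b; c] by rewrite !inE eqxx.
  have c3 : #|[set a; b; c]| = 3 by rewrite -nE.
  have nbr_a y : y \in nbr e a -> y \in ~: [set a; b; c].
    rewrite in_nbr in_setC => ay; apply/negP=> yA.
    by rewrite (no_edge_in3 T aA yA) in ay.
  (* The degree of [a] is at most [n - 3] and its neighbours have degree at most 3, so equality
     fails at [a]. *)
  have := eqS a (S_closed vS va).
  have : walks2 e a <= 3 * #|nbr e a|.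
    rewrite mulnC -sum_nat_const; apply: leq_sum => y /nbr_a; rewrite in_setC => yA.
    rewrite -c3 subset_leq_card //; apply/subsetP=> z; rewrite in_nbr => yz.
    by apply: contraTT yz => zA; apply: indep.
  have : #|nbr e a| + 3 <= n.
    have := cardsC [set a; b; c]; rewrite c3 card_ord.
    have := subset_leq_card (introT subsetP nbr_a).
    by clear; move: #|nbr e a| #|~: _|; lia.
  by clear; move: (walks2 e a) #|nbr e a|; lia.
(* Equality would need [2 * #|B| + 2] links, one more than allowed. *)
- by move: eqv bound cB; rewrite T; clear; move: (links _ _ _ _ _) #|B|; lia.
- move: T; case eab: (e a b); case eac: (e a c); case ebc: (e b c) => // _.
  + by apply: (two_path_of_degree3 n6 eqS vS ba bc ac nE1); rewrite ?ebc // e_sym.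
  + by apply: (two_path_of_degree3 n6 eqS vS ab ac bc nE); rewrite ?eac.
  by apply: (two_path_of_degree3 n6 eqS vS ac ab cb nE2); rewrite ?eab // e_sym.
- exact: (no_triangle_of_degree3 n6 eqS vS ab ac bc nE T).
by move: T; case: (e a b); case: (e a c); case: (e b c).
Qed.

End EqualityCase.

(** * The extremal graphs *)

Lemma card_initial n k : k <= n -> #|[set y : 'I_n | y < k]| = k.
Proof.
move=> kn; rewrite -sum1_card (eq_bigl (fun y : 'I_n => y < k)) => [|y]; last by rewrite inE.
by rewrite (big_ord_narrow kn) sum1_card card_ord.
Qed.

Lemma K3_walks2 n (u : 'I_n) : 3 <= n -> walks2 (@K3_rel n) u = 3 * n - 9.
Proof.
move=> n3; pose A := [set y : 'I_n | y < 3].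
have cA : #|A| = 3 by apply: card_initial.
have cA' : #|~: A| = n - 3.
  by have := cardsC A; rewrite cA card_ord; move: n3; clear; move: #|~: A|; lia.
have nE v : nbr (@K3_rel n) v = if v \in A then ~: A else A.
  by apply/setP=> y; rewrite in_nbr /K3_rel inE; case: ifP => v3; rewrite !inE; case: (y < 3).
rewrite /walks2 nE; case: ifP => uA.
  rewrite (eq_bigr (fun=> 3)) ?sum_nat_const ?cA' => [|y]; first by move: n3; clear; lia.
  by rewrite in_setC nE => /negPf->.
rewrite (eq_bigr (fun=> n - 3)) ?sum_nat_const ?cA => [|y]; first by move: n3; clear; lia.
by rewrite nE => ->.
Qed.

Lemma K11_walks2 n (u : 'I_n) : 2 <= n ->
  walks2 (@K11_rel n) u + 4 = 2 * n + #|nbr (@K11_rel n) u|.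
Proof.
move=> n2; pose A := [set y : 'I_n | y < 2].
have cA : #|A| = 2 by apply: card_initial.
have cA' : #|~: A| = n - 2.
  by have := cardsC A; rewrite cA card_ord; move: n2; clear; move: #|~: A|; lia.
have nE v : nbr (@K11_rel n) v = if v \in A then ~: [set v] else A.
  apply/setP=> y; rewrite in_nbr /K11_rel inE eq_sym ![2 <= _]leqNgt.
  case: ifP => v2; rewrite !inE /= ?andbT // negbK.
  by case: (y =P v) => // ->; rewrite v2.
have dE v : #|nbr (@K11_rel n) v| = if v \in A then n.-1 else 2.
  by rewrite nE; case: ifP => _; rewrite ?cardsC1 ?card_ord.
rewrite /walks2 dE nE; case: ifP => uA.
  rewrite (bigID [in A]) /=.
  rewrite (eq_bigl [in A :\ u]) => [|y]; last by rewrite !inE.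
  rewrite [X in _ + X + _](eq_bigl [in ~: A]) => [|y]; last first.
    rewrite !inE; case: (y =P u) => // ->; by move: uA; rewrite inE => ->.
  rewrite (eq_bigr (fun=> n.-1)) ?sum_nat_const => [|y]; last first.
    by rewrite in_setD1 dE => /andP[_ ->].
  rewrite [X in _ + X + _](eq_bigr (fun=> 2)) ?sum_nat_const ?cA' => [|y]; last first.
    by rewrite in_setC dE => /negPf->.
  have := cardsD1 u A; rewrite uA cA; move: n2; clear.
  by move: #|_ :\ _|; lia.
rewrite (eq_bigr (fun=> n.-1)) ?sum_nat_const ?cA => [|y]; first by move: n2; clear; lia.
by rewrite dE => ->.
Qed.

Lemma set2_eq (T : finType) (x y p q : T) : x != y -> p != q ->
  ([set x; y] == [set p; q]) = (x == p) && (y == q) || (x == q) && (y == p).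
Proof.
move=> xy pq; apply/eqP/orP => [E|[]/andP[/eqP-> /eqP->] //]; last by rewrite setUC.
have := set21 x y; have := set22 x y; rewrite E => /set2P[] yE /set2P[] xE.
all: move: xy; rewrite xE yE ?eqxx //= => _; by [left | right].
Qed.

(** Free of [inord] and of equality of sets, this form can be evaluated at concrete vertices. *)
Lemma F1_relE (x y : 'I_5) : F1_rel x y =
  (x != y :> nat) && [|| (x < 4) && (y < 4), (x == 3 :> nat) && (y == 4 :> nat)
                       | (x == 4 :> nat) && (y == 3 :> nat)].
Proof.
rewrite /F1_rel -val_eqE /=; case: eqVneq => //= xy; congr (_ || _).
by rewrite set2_eq -?val_eqE /= ?inordK.
Qed.

Lemma F1_rel_sym : symmetric F1_rel.
Proof. by move=> x y; rewrite /F1_rel eq_sym setUC [X in X || _]andbC. Qed.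

(** The degree of [u] is 3 or 4 and divisible by three, so [u] and its neighbours form a K_4. The
    two walk bounds leave exactly one edge to the fifth vertex [w]. *)
Lemma windmill5 (e : rel 'I_5) u : symmetric e -> irreflexive e ->
  windmill_center e u -> graph_iso e F1_rel.
Proof.
move=> e_sym e_irr [two_nbrs N2 walks_lt walks_gt N3].
have N_eq : #|nbr e u| = 3.
  have := degree_lt e_irr u; move: N2 N3; clear.
  by case: #|nbr e u| => [|[|[|[|[|d]]]]].
have uN : u \notin nbr e u by rewrite in_nbr e_irr.
have cW : #|~: (u |: nbr e u)| = 1.
  have := cardsC (u |: nbr e u); rewrite cardsU1 uN N_eq card_ord.
  by clear; move: #|~: _|; lia.
have /cards1P[w WE] : #|~: (u |: nbr e u)| == 1 by rewrite cW.
have [wu wN] : w != u /\ ~~ e u w.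
  have : w \in ~: (u |: nbr e u) by rewrite WE set11.
  by rewrite in_setC in_setU1 negb_or in_nbr => /andP[].
have cases x : x != w -> x = u \/ e u x.
  move=> xw; have : x \notin ~: (u |: nbr e u) by rewrite WE in_set1.
  by rewrite in_setC negbK in_setU1 in_nbr => /predU1P.
have full x y : x != w -> y != w -> x != y -> e x y.
  move=> xw yw xy; have [xu|ux] := cases x xw; have [yu|uy] := cases y yw.
  - by move: xy; rewrite xu yu eqxx.
  - by rewrite xu.
  - by rewrite yu e_sym.
  have : nbr e x :&: nbr e u == nbr e u :\ x.
    rewrite eqEcard two_nbrs ?in_nbr //.
    have -> : #|nbr e u :\ x| = 2.
      by have := cardsD1 x (nbr e u); rewrite in_nbr ux N_eq; clear; move: #|_ :\ _|; lia.
    rewrite leqnn andbT.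
    apply/subsetP=> z; rewrite in_setI in_setD1 !in_nbr => /andP[xz ->].
    by rewrite eq_sym (adj_neq e_irr).
  move/eqP/setP/(_ y); rewrite in_setI in_setD1 !in_nbr uy !andbT => ->.
  by rewrite eq_sym.
have dE x : x \in nbr e u -> #|nbr e x| = 3 + e x w.
  rewrite in_nbr => ux; have xw : x != w by apply: contraNneq wN => <-.
  rewrite (cardsD1 w) in_nbr addnC; congr (_ + _).
  have -> : nbr e x :\ w = ~: [set x; w].
    apply/setP=> y; rewrite in_setD1 in_setC in_set2 in_nbr negb_or andbC.
    case yw: (y == w); rewrite ?andbF // !andbT.
    by apply/idP/idP=> [/(adj_neq e_irr)|yx]; [rewrite eq_sym | apply: full; rewrite ?yw // eq_sym].
  by have := cardsC [set x; w]; rewrite cards2 xw card_ord => -[].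
have : #|nbr e w| == 1.
  have -> : #|nbr e w| = \sum_(x in nbr e u) e x w.
    rewrite -sum1_card big_mkcond [RHS]big_mkcond; apply: eq_bigr => x _.
    rewrite !in_nbr (e_sym w); case xw: (e x w); case ux: (e u x) => //.
    have [xu|ux'] := cases x (adj_neq e_irr xw); last by rewrite ux' in ux.
    by rewrite xu (negPf wN) in xw.
  move: walks_lt walks_gt; rewrite /walks2 (eq_bigr _ dE) big_split /= sum_nat_const N_eq.
  by clear; move: (\sum_(x in _) _); lia.
case/cards1P=> a nw.
have wa : e w a by rewrite -in_nbr nw set11.
have aw : a != w by rewrite eq_sym (adj_neq e_irr).
have wE y : e w y = (y == a) by rewrite -in_nbr nw in_set1.
pose p : 'I_5 := inord 3; pose q : 'I_5 := inord 4.
have pq : p != q by rewrite -val_eqE /= !inordK.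
(* The map [f] first sends [w] to 4, then the image [a'] of [a] to 3. As [a'] is not [q], the second
   transposition fixes 4. *)
pose a' := tperm w q a.
have a'q : a' != q by rewrite -[X in _ != X](tpermL w q) (inj_eq perm_inj).
pose f := (tperm w q * tperm a' p)%g.
have fw : f w = q by rewrite permM tpermL tpermD // eq_sym.
have fa : f a = p by rewrite permM -/a' tpermL.
have f4 x : (f x == 4 :> nat) = (x == w).
  by rewrite -(inj_eq (@perm_inj _ f)) fw -val_eqE /= inordK.
have f3 x : (f x == 3 :> nat) = (x == a).
  by rewrite -(inj_eq (@perm_inj _ f)) fa -val_eqE /= inordK.
have flt x : (f x < 4) = (x != w).
  by rewrite -f4; move: (ltn_ord (f x)); clear; move: (val (f x)); lia.
exists f => x y; rewrite F1_relE !f4 !f3 !flt.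
have -> : (f x != f y :> nat) = (x != y) by rewrite (inj_eq val_inj) (inj_eq perm_inj).
have [->|xy] := eqVneq x y; first by rewrite e_irr.
have [xw|xw] /= := eqVneq x w.
  by rewrite xw wE (eq_sym w a) (negPf aw).
have [yw|yw] /= := eqVneq y w; last by rewrite full.
by rewrite yw e_sym wE; case: (x == a).
Qed.

(** * The bounds *)

Local Open Scope ring_scope.

(** At [n = 5] the bound [rho^2 <= 2 n - 4 + rho] means [rho <= 3], so this separates F_1 from the
    graphs without a windmill centre. *)
Lemma F1_spectral_radius_gt3 (R : rcfType) : 3 < spectral_radius R F1_rel.
Proof.
have [x [x0 [u xu] xE]] := @perron_vector R 5 F1_rel isT F1_rel_sym.
have le_sum : x u <= \sum_i x i by rewrite (bigD1 u) //= lerDl sumr_ge0.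
pose i1 : 'I_5 := lift ord0 (ord0 : 'I_4); pose i2 : 'I_5 := lift ord0 (lift ord0 (ord0 : 'I_3)).
pose i3 : 'I_5 := lift ord0 (lift ord0 (lift ord0 (ord0 : 'I_2))).
pose i4 : 'I_5 := lift ord0 (lift ord0 (lift ord0 (lift ord0 (ord0 : 'I_1)))).
move: le_sum (xE ord0) (xE i1) (xE i2) (xE i3) (xE i4).
rewrite ![\sum_(v in _) _]big_mkcond /= !big_ord_recl !big_ord0 !in_nbr !F1_relE /=.
rewrite -/i1 -/i2 -/i3 -/i4 !addr0 !add0r.
move: xu (x0 ord0) (x0 i1) (x0 i2) (x0 i3) (x0 i4).
move: (x u) (x ord0) (x i1) (x i2) (x i3) (x i4) (spectral_radius R F1_rel).
move=> y y0 y1 y2 y3 y4 r y_gt0 p0 p1 p2 p3 p4 le_y E0 E1 E2 E3 E4.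
rewrite ltNge; apply/negP=> r3.
(* Pairing with the test vector (1, 1, 1, 1, 1/3), for which [A y >= 3 y]. *)
have Ey : (r - 3) * (y0 + y1 + y2 + y3 + y4 / 3) = y3 / 3 by lra.
have : 0 <= (3 - r) * (y0 + y1 + y2 + y3 + y4 / 3) by apply: mulr_ge0; lra.
move=> h; have y3_0 : y3 = 0 by lra.
(* The equation at vertex 3, which sees all the others, now makes every entry vanish. *)
by move: E3; rewrite y3_0 mulr0 => E3; lra.
Qed.

Section WindmillFree.
Variables (R : rcfType) (n : nat) (e : rel 'I_n).
Hypotheses (n0 : (0 < n)%N) (e_sym : symmetric e) (e_irr : irreflexive e).
Hypothesis free : ~ contains_DCC1 e.
Notation rho := (spectral_radius R e).

Lemma spectral_radius_cases : (5 <= n)%N ->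
  [\/ (forall u, (walks2 e u + 9 <= 3 * n)%N) /\ rho ^+ 2 <= 3 * (n%:R - 3),
      (forall u, (walks2 e u + 4 <= 2 * n + #|nbr e u|)%N) /\ rho ^+ 2 <= 2 * n%:R - 4 + rho
    | (exists u, windmill_center e u) /\ rho ^+ 2 <= n%:R - 1 + 2 * rho].
Proof.
move=> n5; have [w0|w1|[u wu]] := walks2_trichotomy e_sym e_irr free.
- constructor 1; split=> //; have := @walks2_spectral_le R n e n0 e_sym (3 * n - 9) 0.
  rewrite mul0r addr0 natrB ?natrM; last by rewrite (@leq_mul 3 3) // (leq_trans _ n5).
  move=> h; apply: le_trans (h _) _; last by lra.
  by move=> u; have := w0 u; move: n5; rewrite mul0n; clear; move: (walks2 e u); lia.
- constructor 2; split=> //; have := @walks2_spectral_le R n e n0 e_sym (2 * n - 4) 1.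
  rewrite mul1r natrB ?natrM; last by rewrite (@leq_mul 2 2) // (leq_trans _ n5).
  move=> h; apply: le_trans (h _) _ => // u; have := w1 u; rewrite mul1n.
  by move: n5; clear; move: (walks2 e u) #|_|; lia.
constructor 3; split; first by exists u.
have := @walks2_spectral_le R n e n0 e_sym (n - 1) 2.
rewrite natrB //; apply => v; have := windmill_walks2 e_sym e_irr wu v.
by move: n0; clear; move: (walks2 e v) #|_|; lia.
Qed.

Let rho_ge0 : 0 <= rho := spectral_radius_ge0 R n0 e_sym.

(** At each vertex [walks2] is at most [(n - 1)^2]. Equality at a single vertex makes it and all its
    neighbours, hence all vertices, adjacent to everything else. *)
Lemma spectral_radius_complete : rho <= n%:R - 1 /\
  (rho = n%:R - 1 <-> graph_iso e (@complete_rel n)).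
Proof.
have walks_le u : (walks2 e u <= n.-1 * n.-1 + 0 * #|nbr e u|)%N.
  rewrite addn0; apply: leq_trans (walks2_le_degree e_irr u) _.
  by rewrite leq_mul2r degree_lt ?orbT.
have predE : (n.-1)%:R = n%:R - 1 :> R by rewrite -subn1 natrB.
have n1 : 0 <= n%:R - 1 :> R by rewrite -predE ler0n.
split.
  have := walks2_spectral_le R n0 e_sym walks_le; rewrite natrM predE mul0r addr0 -expr2.
  by rewrite ler_pXn2r // nnegrE.
split=> [rhoE|[f fE]].
  have [|S [/set0Pn[u uS] _ eqS]] := walks2_eq_support n0 e_sym walks_le (R := R).
    by rewrite rhoE natrM predE mul0r addr0 expr2.
  have deg_u : #|nbr e u| = n.-1.
    apply/eqP; rewrite eqn_leq degree_lt //=.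
    have := walks2_le_degree e_irr u; rewrite eqS // addn0 leq_mul2r.
    by case/predU1P => [->|].
  have full v y : #|nbr e v| = n.-1 -> y != v -> e v y by apply: full_degree_adj.
  have all_full v : #|nbr e v| = n.-1.
    have [->//|vu] := eqVneq v u.
    apply/eqP; rewrite eqn_leq degree_lt // leqNgt; apply/negP=> lt_v.
    have : (walks2 e u < #|nbr e u| * n.-1)%N.
      rewrite /walks2 -sum_nat_const.
      rewrite (bigD1 v) ?in_nbr ?full //= [X in (_ < X)%N](bigD1 v) ?in_nbr ?full //=.
      rewrite -addSn leq_add //; apply: leq_sum => w _; exact: degree_lt.
    by rewrite eqS // deg_u addn0 ltnn.
  exists 1%g => x y; rewrite !perm1 /complete_rel.
  by have [->|xy] := eqVneq x y; [rewrite e_irr | apply: full; rewrite // eq_sym].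
have nE v : nbr e v = ~: [set v].
  by apply/setP=> y; rewrite in_nbr fE /complete_rel (inj_eq perm_inj) !inE eq_sym.
have dE v : #|nbr e v| = n.-1 by rewrite nE cardsC1 card_ord.
have := @walks2_spectral_eq R n e n0 e_sym (n.-1 * n.-1) 0.
rewrite natrM predE mul0r addr0 -expr2 => h; apply/eqP; rewrite -(@eqrXn2 _ 2) //.
by apply/eqP/h => u; rewrite addn0 /walks2 (eq_bigr (fun=> n.-1)) // sum_nat_const dE.
Qed.

(** The number [t] is the positive root of [t^2 = 2 n - 4 + t]. In this range the other two cases
    force [rho < t], so equality falls under the second. *)
Lemma spectral_radius_6to9 : (6 <= n <= 9)%N ->
  rho <= 2^-1 + Num.sqrt (2 * n%:R - 15 / 4) /\
  (rho = 2^-1 + Num.sqrt (2 * n%:R - 15 / 4) <-> graph_iso e (@K11_rel n)).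
Proof.
move=> n69; have /andP[n6 n9] := n69; set t := 2^-1 + _.
have N6 : 6 <= n%:R :> R by rewrite ler_nat.
have N9 : n%:R <= 9 :> R by rewrite ler_nat.
have tE : t ^+ 2 = 2 * n%:R - 4 + t.
  have arg_ge0 : 0 <= 2 * n%:R - 15 / 4 :> R by lra.
  by have := sqr_sqrtr arg_ge0; rewrite /t; set s := Num.sqrt _ => sE; rewrite sqrrD sE; field.
have t1 : 1 <= t.
  suff : 2^-1 <= Num.sqrt (2 * n%:R - 15 / 4) :> R by rewrite /t; lra.
  rewrite -[X in X <= _](ger0_norm (x := 2^-1)) ?invr_ge0 // -sqrtr_sqr ler_wsqrtr //.
  by rewrite expr2 -invfM; lra.
have three : (n != 6)%N -> 7 <= n%:R :> R by move=> n6'; rewrite ler_nat; move: n6 n6'; clear; lia.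
have n5 : (5 <= n)%N by apply: leq_trans n6.
have lt_or : rho < t \/ (forall u, (walks2 e u + 4 <= 2 * n + #|nbr e u|)%N) /\ rho <= t.
  have [[_ w0]|[w1 rho1]|[[u [_ d1 _ _ d3]] w2]] := spectral_radius_cases n5.
  - left; rewrite ltNge; apply/negP=> le_t.
    have : t ^+ 2 <= rho ^+ 2 by rewrite ler_pXn2r // nnegrE; lra.
    move=> h; have t_le : t <= n%:R - 5 by lra.
    have : t * (t - 1) <= (n%:R - 5) * (n%:R - 6) by apply: ler_pM; lra.
    have : 0 <= (n%:R - 6) * (9 - n%:R) :> R by apply: mulr_ge0; lra.
    by move: tE; rewrite expr2; nra.
  - right; split=> //; rewrite leNgt; apply/negP=> lt_t.
    have : t * (t - 1) < rho * (rho - 1) by apply: ltr_pM; lra.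
    by move: tE rho1; rewrite !expr2; lra.
  left; rewrite ltNge; apply/negP=> le_t.
  have N7 : 7 <= n%:R :> R.
    (* At [n = 6] the centre would have degree 4 or 5, not a multiple of three. *)
    apply: three; apply: contraTneq d3 => n_6.
    move: (degree_lt e_irr u) d1 n_6; clear; move: #|nbr e u| => d h1 h2 n_6.
    by move: h1 h2; rewrite n_6; case: d => [|[|[|[|[|[|d]]]]]].
  have : t * (t - 2) <= rho * (rho - 2).
    have : 0 <= (rho - t) * (rho + t - 2) by apply: mulr_ge0; lra.
    by nra.
  move=> h; have t_ge : n%:R - 3 <= t by move: tE w2 h; rewrite !expr2; lra.
  have : (n%:R - 3) * (n%:R - 4) <= t * (t - 1) by apply: ler_pM; lra.
  have : 0 <= (n%:R - 7) * (n%:R - 2) :> R by apply: mulr_ge0; lra.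
  by move: tE; rewrite expr2; nra.
split; first by case: lt_or => [/ltW|[]].
split=> [rhoE|iso].
  case: lt_or => [|[w1 _]]; first by rewrite rhoE ltxx.
  have w1' u : (walks2 e u <= 2 * n - 4 + 1 * #|nbr e u|)%N.
    by have := w1 u; move: n6; rewrite mul1n; clear; move: (walks2 e u) #|_|; lia.
  have [|S [S0 S_cl eqS]] := walks2_eq_support n0 e_sym w1' (R := R).
    by rewrite rhoE mul1r natrB ?natrM // ?tE //; move: n6; clear; lia.
  apply: (K11_equality e_sym e_irr free S0 S_cl n69) => u uS.
  by rewrite eqS //; move: n6; rewrite mul1n; clear; move: #|_|; lia.
have K11_sym : symmetric (@K11_rel n) by move=> x y; rewrite /K11_rel eq_sym [X in _ && ~~ X]andbC.
rewrite (spectral_radius_iso R iso).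
have r0 := spectral_radius_ge0 R n0 K11_sym.
have := @walks2_spectral_eq R n (@K11_rel n) n0 K11_sym (2 * n - 4) 1.
rewrite mul1r natrB ?natrM; last by move: n6; clear; lia.
move=> h; have {}h := h _.
have rE : spectral_radius R (@K11_rel n) ^+ 2 = 2 * n%:R - 4 + spectral_radius R (@K11_rel n).
  apply: h => u; have := @K11_walks2 n u; rewrite mul1n; move: n6; clear.
  by move: (walks2 _ u) #|_|; lia.
(* Both numbers solve the same quadratic, whose other root is [1 - t], at most 0. *)
have : (spectral_radius R (@K11_rel n) - t) * (spectral_radius R (@K11_rel n) + t - 1) = 0.
  by move: rE tE; rewrite !expr2; nra.
move/eqP; rewrite mulf_eq0 subr_eq0 => /orP[/eqP//|/eqP].
move=> sum0; have r_t : spectral_radius R (@K11_rel n) = 0 /\ t = 1 by split; lra.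
by move: tE; rewrite r_t.2 expr1n; lra.
Qed.

(** If [rho >= t], the second case would give [t >= n - 5] and the third [t >= n - 4]. Both
    contradict [t^2 = 3 (n - 3)] once [n >= 10], so equality falls under the first case. *)
Lemma spectral_radius_ge10 : (10 <= n)%N ->
  rho <= Num.sqrt (3 * (n%:R - 3)) /\
  (rho = Num.sqrt (3 * (n%:R - 3)) <-> graph_iso e (@K3_rel n)).
Proof.
move=> n10; set t := Num.sqrt _.
have N10 : 10 <= n%:R :> R by rewrite ler_nat.
have tE : t ^+ 2 = 3 * (n%:R - 3) by rewrite sqr_sqrtr //; lra.
have t0 : 0 <= t by apply: sqrtr_ge0.
have t4 : 4 <= t.
  by rewrite -(@ler_pXn2r _ 2) ?nnegrE // tE expr2; lra.
have n5 : (5 <= n)%N by apply: leq_trans n10.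
have lt_or : rho < t \/ (forall u, (walks2 e u + 9 <= 3 * n)%N) /\ rho <= t.
  have [[w0 rho0]|[_ w1]|[_ w2]] := spectral_radius_cases n5.
  - right; split=> //.
    by rewrite -(@ler_pXn2r _ 2) ?nnegrE // tE.
  - left; rewrite ltNge; apply/negP=> le_t.
    have : t * (t - 1) <= rho * (rho - 1) by apply: ler_pM; lra.
    move=> h; have t_ge : n%:R - 5 <= t by move: tE h w1; rewrite !expr2; lra.
    have : (n%:R - 5) ^+ 2 <= t ^+ 2 by rewrite ler_pXn2r // nnegrE; lra.
    have : 0 <= (n%:R - 10) * (n%:R - 3) :> R by apply: mulr_ge0; lra.
    by rewrite tE !expr2; nra.
  left; rewrite ltNge; apply/negP=> le_t.
  have : t * (t - 2) <= rho * (rho - 2).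
    have : 0 <= (rho - t) * (rho + t - 2) by apply: mulr_ge0; lra.
    by nra.
  move=> h; have t_ge : n%:R - 4 <= t by move: tE h w2; rewrite !expr2; lra.
  have : (n%:R - 4) ^+ 2 <= t ^+ 2 by rewrite ler_pXn2r // nnegrE; lra.
  have : 0 <= (n%:R - 10) * (n%:R - 1) :> R by apply: mulr_ge0; lra.
  by rewrite tE !expr2; nra.
split; first by case: lt_or => [/ltW|[]].
have natE : (3 * n - 9)%:R = 3 * (n%:R - 3) :> R.
  rewrite natrB ?natrM; first by lra.
  by move: n10; clear; lia.
split=> [rhoE|iso].
  case: lt_or => [|[w0 _]]; first by rewrite rhoE ltxx.
  have w0' u : (walks2 e u <= 3 * n - 9 + 0 * #|nbr e u|)%N.
    by have := w0 u; move: n10; rewrite mul0n; clear; move: (walks2 e u); lia.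
  have [|S [S0 S_cl eqS]] := walks2_eq_support n0 e_sym w0' (R := R).
    by rewrite rhoE mul0r addr0 natE.
  apply: (K3_equality e_sym e_irr free S0 S_cl n10) => u uS.
  by rewrite eqS // addn0.
have K3_sym : symmetric (@K3_rel n) by move=> x y; rewrite /K3_rel eq_sym.
rewrite (spectral_radius_iso R iso).
have r0 := spectral_radius_ge0 R n0 K3_sym.
have := @walks2_spectral_eq R n (@K3_rel n) n0 K3_sym (3 * n - 9) 0.
rewrite mul0r addr0 natE -tE => h; apply/eqP; rewrite -(@eqrXn2 _ 2) //; apply/eqP/h => u.
by rewrite addn0 K3_walks2 // (leq_trans _ n10).
Qed.

End WindmillFree.

Lemma spectral_radius_5 (R : rcfType) (e : rel 'I_5) :
  symmetric e -> irreflexive e -> ~ contains_DCC1 e ->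
  spectral_radius R e <= spectral_radius R F1_rel /\
  (spectral_radius R e = spectral_radius R F1_rel <-> graph_iso e F1_rel).
Proof.
move=> e_sym e_irr free.
have F1_gt3 := F1_spectral_radius_gt3 R.
have [lt_F1|iso] : spectral_radius R e < spectral_radius R F1_rel \/ graph_iso e F1_rel.
  have [[_ w]|[_ w]|[[u wu] _]] := @spectral_radius_cases R 5 e isT e_sym e_irr free isT.
  - left; apply: le_lt_trans F1_gt3; rewrite leNgt; apply/negP=> gt3.
    by move: w; rewrite expr2; nra.
  - left; apply: le_lt_trans F1_gt3; rewrite leNgt; apply/negP=> gt3.
    by move: w; rewrite expr2; nra.
  by right; apply: windmill5 wu.
- split; first exact: ltW.
  split=> [eqF1|/(spectral_radius_iso R)//].
  by rewrite eqF1 ltxx in lt_F1.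
by rewrite (spectral_radius_iso R iso).
Qed.

Theorem theorem1p2 (R : rcfType) (n : nat) (e : rel 'I_n) :
  (1 <= n)%N -> simple_graph e -> ~ contains_DCC1 e ->
  [/\ (n <= 4)%N ->
        spectral_radius R e <= n%:R - 1 /\
        (spectral_radius R e = n%:R - 1 <-> graph_iso e (@complete_rel n)),
      n = 5%N ->
        spectral_radius R e <= spectral_radius R F1_rel /\
        (spectral_radius R e = spectral_radius R F1_rel <->
           exists h : n = 5%N, graph_iso (fun x y => e (cast_ord (esym h) x) (cast_ord (esym h) y)) F1_rel),
      (6 <= n <= 9)%N ->
        spectral_radius R e <= 2^-1 + Num.sqrt (2 * n%:R - 15 / 4) /\
        (spectral_radius R e = 2^-1 + Num.sqrt (2 * n%:R - 15 / 4) <->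
           graph_iso e (@K11_rel n)) &
      (10 <= n)%N ->
        spectral_radius R e <= Num.sqrt (3 * (n%:R - 3)) /\
        (spectral_radius R e = Num.sqrt (3 * (n%:R - 3)) <-> graph_iso e (@K3_rel n))].
Proof.
move=> n0 [e_sym e_irr] free; split.
- by move=> _; apply: spectral_radius_complete.
- move=> n5; subst n.
  have [le_F1 eq_F1] := spectral_radius_5 R e_sym e_irr free; split=> //.
  apply: (iff_trans eq_F1); split=> [[f fE]|[h [f fE]]].
    by exists erefl, f => x y; rewrite !cast_ord_id.
  by exists f => x y; rewrite -fE !cast_ord_id.
- exact: spectral_radius_6to9.
exact: spectral_radius_ge10.
Qed.
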